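(* Let $\mu$ be a Borel probability measure with compact support on $\mathbb{R}^n$ and let $m\in\mathbb{N}$ with $1\leq m\leq n$. Let $D(\mu)$ be the threshold parameter of $\mu$. Then $$\dim_P \mu_V = m \ \text{ for } \gamma_{n,m}\text{-a.e. } V\in G(n,m) \quad\Longleftrightarrow\quad m\leq D(\mu).$$
   Context: $G(n,m)$ is the Grassmannian of $m$-dimensional linear subspaces of $\mathbb{R}^n$ with its natural rotation-invariant Borel probability measure $\gamma_{n,m}$. For $V\in G(n,m)$, $\pi_V:\mathbb{R}^n\to V$ is the orthogonal projection and $\mu_V=\mu\circ\pi_V^{-1}$, a Borel measure on $V\cong\mathbb{R}^m$. The packing dimension of a finite Borel measure $\nu$ is $\dim_P\nu=\inf\{\dim_P A: A \text{ Borel},\ \nu(A)>0\}$, where $\dim_P A$ is the packing dimension of the set $A$. Threshold parameter: for $\theta\in(0,1]$, $x\in\mathbb{R}^n$, $r>0$ and $0\le t\le s$, put $$F_{t,s,\theta}^{\mu}(x,r)=\int\min\{1,\ r^t|x-y|^{-t},\ r^{\theta(s-t)+t}|x-y|^{-s}\}\,d\mu(y)$$ (the integrand is $1$ when $y=x$), and $$\dim_{P,\theta}\mu=\sup\Bigl\{t\in[0,n]:\ \liminf_{r\to0} r^{-t}F_{t,n,\theta}^{\mu}(x,r)=0\ \text{ for }\mu\text{-a.e. }x\in\mathbb{R}^n\Bigr\},$$ with the convention $\sup\emptyset=0$. The function $\theta\mapsto\dim_{P,\theta}\mu$ is nondecreasing on $(0,1]$, and the threshold parameter is $D(\mu):=\lim_{\theta\to0^+}\dim_{P,\theta}\mu=\inf_{\theta\in(0,1]}\dim_{P,\theta}\mu$.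 *)

(* Defs.v *)
From HB Require Import structures.
From mathcomp Require Import all_boot all_order all_algebra.
From mathcomp Require Import all_classical all_reals all_analysis.

Set Implicit Arguments.
Unset Strict Implicit.
Unset Printing Implicit Defensive.

Import Order.TTheory GRing.Theory Num.Theory.
Import numFieldNormedType.Exports.

Local Open Scope classical_set_scope.
Local Open Scope ring_scope.

Notation borel T := (g_sigma_algebraType (@open T)).

(* The library norm of 'rV[R]_n is the sup norm; both give the same topology. *)
Definition enorm (R : realType) (n : nat) (x : 'rV[R]_n) : R :=
  Num.sqrt (\sum_(i < n) x ord0 i ^+ 2).

Definition eball (R : realType) (n : nat) (x : 'rV[R]_n) (r : R) :
    set 'rV[R]_n :=
  [set y | enorm (y - x) <= r].

Definition msupport (R : realType) (n : nat)
    (mu : {measure set (borel 'rV[R]_n) -> \bar R}) : set 'rV[R]_n :=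
  [set x | forall U : set 'rV[R]_n, open U -> U x -> (0 < mu U)%E].

Section PackingDimension.
Variables (R : realType) (n : nat).
Implicit Types (A : set 'rV[R]_n) (s d : R).

(* A countable (possibly finite) family of disjoint closed balls, indexed by
   I, with centres c i in A and radii r i at most d. *)
Definition is_packing d A (I : set nat) (c : nat -> 'rV[R]_n) (r : nat -> R) :
    Prop :=
  (forall i, I i -> A (c i) /\ 0 < r i <= d) /\
  trivIset I (fun i => eball (c i) (r i)).

Definition packing_presum s d A : \bar R :=
  ereal_sup [set e | exists I c r, is_packing d A I c r /\
    e = (\esum_(i in I) ((2 * r i) `^ s)%:E)%E].

(* The limit as d -> 0+ is an infimum, packing_presum being nondecreasing
   in d. *)
Definition packing_premeasure s A : \bar R :=
  ereal_inf [set packing_presum s d A | d in [set d : R | 0 < d]].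

Definition packing_measure s A : \bar R :=
  ereal_inf [set (\sum_(0 <= i <oo) packing_premeasure s (F i))%E | F in
    [set F : nat -> set 'rV[R]_n | A `<=` \bigcup_i F i]].

Definition packing_dim A : \bar R :=
  ereal_inf [set s%:E | s in [set s : R | 0 <= s /\ packing_measure s A = 0%E]].

Definition packing_dim_measure (nu : set (borel 'rV[R]_n) -> \bar R) :
    \bar R :=
  ereal_inf [set packing_dim A | A in
    [set A : set (borel 'rV[R]_n) | measurable A /\ (0 < nu A)%E]].

End PackingDimension.

Section Threshold.
Variables (R : realType) (n : nat).
Variable mu : {measure set (borel 'rV[R]_n) -> \bar R}.
Implicit Types (t s theta r d : R) (x : 'rV[R]_n).

(* d stands for |x - y|; at d = 0 the powers d `^ (- t) are junk values. *)
Definition threshold_kernel t s theta r d : R :=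
  if d == 0 then 1
  else Num.min 1 (Num.min (r `^ t * d `^ (- t))
                          (r `^ (theta * (s - t) + t) * d `^ (- s))).

Definition threshold_potential t s theta x r : \bar R :=
  (\int[mu]_y (threshold_kernel t s theta r (enorm (x - (y : 'rV[R]_n))))%:E)%E.

(* The real-valued sup of the library satisfies sup set0 = 0, and the set
   below is bounded by n. *)
Definition packing_dim_theta theta : R :=
  sup [set t : R | 0 <= t <= n%:R /\
    {ae mu, forall x : 'rV[R]_n,
      limf_einf (fun r : R => (r `^ (- t))%:E *
                              threshold_potential t n%:R theta x r)%E
                0^'+ = 0%E}].

Definition threshold : R :=
  lim (packing_dim_theta theta @[theta --> 0^'+]).

End Threshold.

Section Grassmannian.
Variables (R : realType) (n : nat).
Implicit Types V : {vspace 'rV[R]_n}.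

Definition basis_mx V : 'M[R]_(\dim V, n) :=
  \matrix_(i < \dim V) (vbasis V)`_i.

Definition orthv V : {vspace 'rV[R]_n} := lker (linfun (mulmxr (basis_mx V)^T)).

Definition orthproj V : 'rV[R]_n -> 'rV[R]_n := daddv_pi V (orthv V).

Lemma orthvP V (x : 'rV[R]_n) :
  reflect (forall v, v \in V -> x *m v^T = 0) (x \in orthv V).
Proof.
apply: (iffP idP).
  rewrite memv_ker lfunE /= => /eqP h v /coord_vbasis ->.
  rewrite linear_sum mulmx_sumr big1// => i _.
  rewrite linearZ/= -scalemxAr.
  suff -> : x *m ((vbasis V)`_i)^T = 0 by rewrite scaler0.
  have /matrixP/(_ 0 i) := h; rewrite !mxE => hi.
  apply/matrixP => a b; rewrite !ord1 !mxE -[RHS]hi.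
  by apply: eq_bigr => k _; rewrite !mxE.
move=> h; rewrite memv_ker lfunE /=; apply/eqP/matrixP => a i.
have iV : (vbasis V)`_i \in V by rewrite vbasis_mem// mem_nth// size_tuple.
have /matrixP/(_ 0 0) := h _ iV; rewrite !mxE => hi.
rewrite ord1 -[RHS]hi.
by apply: eq_bigr => k _; rewrite !mxE.
Qed.

Lemma capv_orthv V : (V :&: orthv V = 0)%VS.
Proof.
apply/eqP; rewrite -subv0; apply/subvP => v; rewrite memv_cap => /andP[vV].
move=> /orthvP/(_ _ vV)/matrixP/(_ ord0 ord0); rewrite !mxE => h.
rewrite memv0; apply/eqP/rowP => i; rewrite mxE.
apply/eqP; rewrite -sqrf_eq0; apply/eqP.
have {}h : \sum_(j < n) v ord0 j ^+ 2 = 0.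
  by rewrite -[RHS]h; apply: eq_bigr => j _; rewrite mxE expr2.
by apply: (psumr_eq0P _ h) => // j _; exact: sqr_ge0.
Qed.

Lemma addv_orthv V : (V + orthv V = fullv)%VS.
Proof.
apply/eqP; rewrite eqEdim subvf dimv_disjoint_sum ?capv_orthv//.
rewrite -(limg_ker_dim (linfun (mulmxr (basis_mx V)^T)) fullv) capfv addnC.
rewrite leq_add2r; apply: (leq_trans (dimvS (subvf _))).
by rewrite dimvf /dim /= mul1n.
Qed.

Lemma orthproj_mem V (x : 'rV[R]_n) : orthproj V x \in V.
Proof. exact: memv_pi. Qed.

Lemma orthproj_orth V (x v : 'rV[R]_n) :
  v \in V -> (x - orthproj V x) *m v^T = 0.
Proof.
apply/orthvP.
have xVV : x \in (V + orthv V)%VS by rewrite addv_orthv memvf.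
have xE := daddv_pi_add (capv_orthv V) xVV.
by rewrite -[X in X - _]xE /orthproj addrAC subrr add0r memv_pi.
Qed.

Lemma exists_dim m : (m <= n)%N -> exists V : {vspace 'rV[R]_n}, \dim V == m.
Proof.
move=> mn; exists <<take m (vbasis {: 'rV[R]_n})>>%VS.
have sz : size (take m (vbasis {: 'rV[R]_n})) = m.
  by rewrite size_takel// size_tuple dimvf /dim /= mul1n.
rewrite -[X in _ == X]sz -/(free _).
apply: (@catl_free _ _ (drop m (vbasis {: 'rV[R]_n}))).
by rewrite cat_take_drop; exact: basis_free (vbasisP _).
Qed.

(* G(n,m); the proof of m <= n makes the type non-empty, hence pointed. *)
Definition grassmann m (le_mn : (m <= n)%N) : Type :=
  {V : {vspace 'rV[R]_n} | \dim V == m}.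

End Grassmannian.

Section GrassmannTopology.
Variables (R : realType) (n m : nat) (le_mn : (m <= n)%N).

HB.instance Definition _ := Choice.on (@grassmann R n m le_mn).
HB.instance Definition _ := isPointed.Build (@grassmann R n m le_mn)
  (let: exist V h := cid (@exists_dim R n m le_mn) in exist _ V h).

(* The topology of the metric |pi_V - pi_W|: the initial one for
   V |-> pi_V, the projection being read as its matrix. *)
Definition grassmann_mx (V : @grassmann R n m le_mn) : 'M[R]_n :=
  lin1_mx (orthproj (sval V)).

HB.instance Definition _ := Topological.copy (@grassmann R n m le_mn)
  (initial_topology grassmann_mx).

(* gamma (U V, V in A) = gamma A for every orthogonal matrix U; rows are
   vectors, so that U acts on the right. *)
Definition rotation_invariant
    (gamma : set (borel (@grassmann R n m le_mn)) -> \bar R) : Prop :=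
  forall U : 'M[R]_n, U *m U^T = 1%:M ->
  forall A : set (borel (@grassmann R n m le_mn)), measurable A ->
    gamma [set W | exists2 V, A V &
             sval W = (linfun (mulmxr U) @: sval V)%VS] = gamma A.

Definition measure_proj (mu : {measure set (borel 'rV[R]_n) -> \bar R})
    (V : borel (@grassmann R n m le_mn)) : set (borel 'rV[R]_n) -> \bar R :=
  pushforward mu (orthproj (sval V) : borel 'rV[R]_n -> borel 'rV[R]_n).

End GrassmannTopology.

Arguments grassmann R {n m} le_mn.

(* Main.v *)
(* Write F_m(x,r) for the integral of min{1, (r/|x-y|)^m} dmu(y).

   Comparing kernels pointwise, m <= D(mu) holds iff for all t < m the lower
   limit of r^-t F_m(x,r) as r -> 0 vanishes for mu-a.e. x.  Likewise
   dim_P nu >= m iff for all t < m the lower limit of r^-t nu(B(z,r)) vanishes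
   for nu-a.e. z; all limits may be taken along r = 2^-j.

   If dim_P mu_V = m for a single V, then F_m(x,r) vanishes as required: the
   measure mu_V lives on an m-dimensional space, so for a.e. x it satisfies
   mu_V(B(P_V x, 2^k r)) <= 2^(km) r^-e mu_V(B(P_V x,r)) for all small r = 2^-j and
   k <= j (a Borel-Cantelli argument on grid cells), and summing over k bounds
   F_m(x,r) by r^(-2e) mu_V(B(P_V x,r)) + r^m.  The same doubling property gives
   dim_P mu_V <= m for every V.

   Conversely gamma{V : |P_V x| <= r} <= C (r/|x|)^m, so by Fubini the integral
   of mu_V(B(P_V x,r)) over V is at most C F_m(x,r), and Fatou's lemma along
   r = 2^-j transfers the vanishing lower limit to a.e. V. *)
From HB Require Import structures.
Require Import Defs.
From mathcomp Require Import all_boot all_order all_algebra.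
From mathcomp Require Import all_classical all_reals all_analysis.
From mathcomp Require Import measurable_realfun lra ring zify.

Import Order.TTheory GRing.Theory Num.Theory.
Import numFieldNormedType.Exports.

Local Open Scope classical_set_scope.
Local Open Scope ring_scope.

Set Implicit Arguments.
Unset Strict Implicit.
Unset Printing Implicit Defensive.

(** The kernels defining [D(mu)] depend on [theta], whereas F_m does not, and each comparison costs
    a power of r. Bounding the threshold potential by F_m asks for the decay exponent m - theta (m -
    t), which is below m for every [theta] in (0, 1]. Bounding F_m by the threshold potential leaves
    an additive error r^(m (1 - theta)), harmless at exponent t once [theta] is so small that m (1 -
    theta) > t; this is what the limit in [theta] provides.

    The doubling loss must be 2^(km) and not 2^(kn), so the projected measure is carried in two
    forms: [P] on R^n, as in the statement, and [N] on R^m, read in an orthonormal basis of V.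

    About gamma only rotation invariance is known. Hence gamma{V : |P_V x| <= r} is the same for all
    vectors x of one length, and it can be averaged over the points of a finite grid after
    rescaling. The average is then bounded for each V separately by counting lattice points near
    V^perp, and no formula for gamma enters. *)

Section Borel.
Variable R : realType.

Lemma continuous_borel_measurable (T : ptopologicalType) (f : T -> R) :
  continuous f -> measurable_fun setT (f : borel T -> R).
Proof.
move=> /continuousP cf; apply: (measurability _ (RGenOpens.measurableE R)).
move=> _ [_ [a [b ->] <-]]; rewrite setTI.
by apply: sub_sigma_algebra; exact/cf/interval_open.
Qed.

Lemma measurable_coord (n : nat) (i : 'I_n) :
  measurable_fun setT (fun x : borel 'rV[R]_n => (x : 'rV[R]_n) ord0 i).
Proof. by apply: continuous_borel_measurable; exact: coord_continuous. Qed.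

End Borel.

(** * The Euclidean norm on row vectors *)

Section Enorm.
Variables (R : realType) (n : nat).
Implicit Types x y : 'rV[R]_n.

Lemma enorm_ge0 x : 0 <= enorm x.
Proof. exact: sqrtr_ge0. Qed.

Lemma enorm_sqr x : enorm x ^+ 2 = \sum_(i < n) x ord0 i ^+ 2.
Proof. by rewrite sqr_sqrtr// sumr_ge0// => i _; exact: sqr_ge0. Qed.

Lemma enormN x : enorm (- x) = enorm x.
Proof. by congr Num.sqrt; apply: eq_bigr => i _; rewrite !mxE sqrrN. Qed.

Lemma enorm_distC x y : enorm (x - y) = enorm (y - x).
Proof. by rewrite -enormN opprB. Qed.

Lemma enorm0 : enorm (0 : 'rV[R]_n) = 0.
Proof.
by rewrite /enorm big1 ?sqrtr0// => i _; rewrite mxE expr0n.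
Qed.

Lemma enormZ (c : R) x : enorm (c *: x) = `|c| * enorm x.
Proof.
rewrite /enorm -sqrtr_sqr -sqrtrM ?sqr_ge0//; congr Num.sqrt.
by rewrite mulr_sumr; apply: eq_bigr => i _; rewrite mxE exprMn.
Qed.

Lemma coord_le_enorm x i : `|x ord0 i| <= enorm x.
Proof.
rewrite -sqrtr_sqr ler_wsqrtr// (bigD1 i)//= lerDl sumr_ge0// => j _.
exact: sqr_ge0.
Qed.

Lemma enorm_eq0 x : (enorm x == 0) = (x == 0).
Proof.
apply/eqP/eqP => [x0|->]; last exact: enorm0.
apply/rowP => i; rewrite mxE; apply/eqP; rewrite -normr_le0 -x0.
exact: coord_le_enorm.
Qed.

(** The crude factor [n.+1] replaces the square root of n: it is an integer, and it stays positive
    for n = 0, so that scales can be divided by it. *)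
Lemma enorm_le_coord x (h : R) :
  (forall i, `|x ord0 i| <= h) -> 0 <= h -> enorm x <= n.+1%:R * h.
Proof.
move=> xh h0; rewrite -(ler_pXn2r (n := 2))// ?nnegrE ?enorm_ge0 ?mulr_ge0//.
rewrite enorm_sqr exprMn (le_trans (ler_sum _ (G := fun=> h ^+ 2) _))//.
  by move=> i _; rewrite -[leLHS]real_normK ?num_real// ler_pXn2r ?nnegrE.
rewrite sumr_const card_ord -[leLHS]mulr_natl ler_wpM2r ?sqr_ge0//.
by rewrite -natrX ler_nat (leq_trans (leqnSn _))// leq_pmulr.
Qed.

End Enorm.

Section CountableFamilies.
Context d (T : measurableType d) (R : realType) (I : countType).
Variable mu : {measure set T -> \bar R}.
Variables (D : set I) (F : I -> set T).
Hypothesis mF : forall i, measurable (F i).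

(** Reindexes the family by [nat] through [pickle], with [set0] at the codes outside [D], so that
    sigma-additivity of sequences applies. *)
Let G (k : nat) : set T :=
  if pickle_inv k is Some i then (if i \in D then F i else set0) else set0.

Let mG k : measurable (G k).
Proof. by rewrite /G; case: pickle_inv => [i|]//; case: ifP. Qed.

Let GE : \bigcup_k G k = \bigcup_(i in D) F i.
Proof.
apply/seteqP; split => [x [k _]|x [i Di Fix]].
  by rewrite /G; case: pickle_inv => [i|]//; case: ifPn => // /set_mem Di Fi;
    exists i.
by exists (pickle i) => //; rewrite /G pickleK_inv mem_set.
Qed.

Let sumG : (\sum_(k <oo) mu (G k) = \esum_(i in D) mu (F i))%E.
Proof.
rewrite nneseries_esumT; last by move=> n; exact: measure_ge0.
transitivity (\esum_(k in [set pickle i | i in D]) mu (G k))%E.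
  rewrite [RHS]esum_mkcond; apply: eq_esum => k _; case: ifPn => // /negP kD.
  rewrite /G; case E : (pickle_inv k) => [i|]; last by rewrite measure0.
  case: ifPn => [/set_mem Di|]; last by rewrite measure0.
  exfalso; apply: kD; apply/mem_set; exists i => //.
  by have := @pickle_invK I k; rewrite E.
rewrite esum_image.
  by apply: eq_esum => i Di; rewrite /G pickleK_inv mem_set.
by move=> i j _ _ /(pcan_inj pickleK).
Qed.

Lemma measurable_countable_bigcup : measurable (\bigcup_(i in D) F i).
Proof. by rewrite -GE; apply: bigcupT_measurable. Qed.

Lemma measure_countable_bigcup_le :
  (mu (\bigcup_(i in D) F i) <= \esum_(i in D) mu (F i))%E.
Proof.
rewrite -sumG -GE; apply: measure_sigma_subadditive => //.
exact: bigcupT_measurable.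
Qed.

Lemma measure_countable_bigcup : trivIset D F ->
  (mu (\bigcup_(i in D) F i) = \esum_(i in D) mu (F i))%E.
Proof.
move=> tF; rewrite -sumG -GE measure_semi_bigcup//.
  move=> k l _ _; rewrite /G => -[x].
  case Ek : (pickle_inv k) => [i|]; last by case.
  case Ei : (i \in D); last by case.
  case El : (pickle_inv l) => [j|]; last by case.
  case Ej : (j \in D); last by case.
  move=> xij; have ij : i = j by apply: tF; [exact/set_mem|exact/set_mem|exists
    x].
  have := @pickle_invK I k; have := @pickle_invK I l.
  by rewrite Ek El /= ij => -> ->.
exact: bigcupT_measurable.
Qed.

End CountableFamilies.

Definition dyad (R : realType) (j : nat) : R := 2^-1 ^+ j.

(** * Grid cells, Borel-Cantelli and the doubling property *)

Section Cells.
Variables (R : realType) (n : nat) (h : R).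
Hypothesis h0 : 0 < h.
Implicit Types (a b : 'rV[int]_n) (x y : 'rV[R]_n).

Definition grid_index x : 'rV[int]_n := \row_i Num.floor (x ord0 i / h).

Definition cell a : set (borel 'rV[R]_n) := [set x | grid_index x = a].

Lemma measurable_cell a : measurable (cell a).
Proof using h0.
have -> : cell a = \bigcap_(i in [set: 'I_n])
    ((fun x : borel 'rV[R]_n => (x : 'rV[R]_n) ord0 i) @^-1`
      `[(a ord0 i)%:~R * h, (a ord0 i + 1)%:~R * h[%classic).
  apply/seteqP; split=> [x xa i _|x xa] /=.
    rewrite in_itv/= -ler_pdivlMr// -ltr_pdivrMr// -floor_eq.
    by move/rowP/(_ i) : xa; rewrite mxE => ->.
  apply/rowP => i; rewrite mxE; apply/eqP; rewrite floor_eq.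
  by have /= := xa i I; rewrite in_itv/= -ler_pdivlMr// -ltr_pdivrMr//.
apply: fin_bigcap_measurable => // i _.
rewrite -[X in measurable X]setTI; apply: measurable_coord => //.
Qed.

Lemma cell_diam a x y : cell a x -> cell a y -> enorm (x - y) <= n.+1%:R * h.
Proof using h0.
move=> <- yx; apply: enorm_le_coord; last exact: ltW.
move=> i; rewrite !mxE.
move/rowP/(_ i) : yx; rewrite !mxE => yx.
have := floor_itv (x ord0 i / h); have := floor_itv (y ord0 i / h).
rewrite yx !intrD !ler_pdivlMr// !ltr_pdivrMr// !mulrDl !mul1r.
by rewrite ler_norml => /andP[? ?] /andP[? ?]; apply/andP; split; lra.
Qed.

Lemma grid_index_near x y i (K : nat) : `|x ord0 i - y ord0 i| <= K%:R * h ->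
  `|grid_index x ord0 i - grid_index y ord0 i| <= K%:Z.
Proof using h0.
have step (u v : R) : u - v <= K%:R * h ->
    Num.floor (u / h) <= Num.floor (v / h) + K%:Z.
  move=> uv; rewrite -(@intrKfloor R K%:Z) -floorDrz ?intr_int//.
  apply: le_floor; rewrite ler_pdivrMr// mulrDl divfK ?gt_eqF//.
  by rewrite -lerBlDl.
rewrite !ler_norml !mxE => /andP[h1 h2].
have xy := step _ _ h2.
have yx : Num.floor (y ord0 i / h) <= Num.floor (x ord0 i / h) + K%:Z.
  by apply: step; rewrite -lerN2 opprB.
lia.
Qed.

(** The vectors of {-K, ..., K}^n, coded by a finite function type so that their number (2K + 1)^n
    is a cardinality. *)
Definition offset (K : nat) (f : {ffun 'I_n -> 'I_(2 * K).+1}) : 'rV[int]_n :=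
  \row_i ((f i : nat)%:Z - K%:Z).

Lemma grid_index_offset x y (K : nat) : enorm (y - x) <= K%:R * h ->
  exists f : {ffun 'I_n -> 'I_(2 * K).+1},
    grid_index y = grid_index x + offset f.
Proof using h0.
move=> xy; exists [ffun i => inord (absz (grid_index y ord0 i - grid_index x
  ord0 i + K%:Z))].
apply/rowP => i.
have : `|grid_index y ord0 i - grid_index x ord0 i| <= K%:Z.
  by apply: grid_index_near; apply: le_trans xy;
    have := coord_le_enorm (y - x) i; rewrite !mxE.
rewrite [RHS]mxE [offset _ _ _]mxE ffunE; move: (grid_index y _ _) (grid_index
  x _ _) => u v uv.
rewrite inordK; lia.
Qed.

End Cells.

(** Serves twice: in the doubling property and in the packing estimate the exceptional sets at scale
    2^-j have mass decaying geometrically in j. *)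
Lemma geometric_borel_cantelli d (T : measurableType d) (R : realType)
    (mu : {measure set T -> \bar R}) (F : nat -> set T) (a q : R) :
  0 <= a -> 0 < q < 1 -> (forall j, measurable (F j)) ->
  (forall j, (mu (F j) <= (a * q ^+ j)%:E)%E) ->
  {ae mu, forall x, exists J, forall j, (J <= j)%N -> ~ F j x}.
Proof.
move=> a0 /andP[q0 q1] mF Fle.
have sF : (\sum_(j <oo) mu (F j) < +oo)%E.
  apply: (@le_lt_trans _ _ (a * (1 - q)^-1)%:E); last exact: ltry.
  apply: lime_le; first exact: is_cvg_nneseries.
  apply: nearW => k; apply: (@le_trans _ _ (series (geometric a q) k)%:E).
    by rewrite /series /= -sumEFin; apply: lee_sum => j _; exact: Fle.
  by rewrite lee_fin geometric_le_lim// ger0_norm// ltW.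
exists (lim_sup_set F); split.
- apply: bigcapT_measurable => k; exact: bigcup_measurable.
- exact: lim_sup_set_cvg0.
- move=> x /= nx k _; apply: contrapT => h; apply: nx; exists k => j kj Fjx.
  by apply: h; exists j.
Qed.

Lemma measure_bigsetU_le d (T : measurableType d) (R : realType)
    (mu : {measure set T -> \bar R}) (I : Type) (r : seq I) (F : I -> set T) :
  (forall i, measurable (F i)) ->
  (mu (\big[setU/set0]_(i <- r) F i) <= \sum_(i <- r) mu (F i))%E.
Proof.
move=> mF; elim: r => [|i r IH]; first by rewrite !big_nil measure0.
rewrite !big_cons (le_trans (measureU2 mu (mF i) _))//; last by rewrite leeD2l.
exact: bigsetU_measurable.
Qed.

Section Enorm_measurable.
Variables (R : realType) (n : nat).

Lemma measurable_enorm d (T : measurableType d) (u : T -> 'rV[R]_n) :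
  (forall i, measurable_fun setT (fun z => u z ord0 i)) ->
  measurable_fun setT (fun z => enorm (u z)).
Proof.
move=> mu; apply: (@measurableT_comp _ _ _ _ _ _ (@Num.sqrt R)).
  by apply: continuous_measurable_fun; exact: sqrt_continuous.
by apply: measurable_sum => i; exact: measurable_funX.
Qed.

Lemma measurable_le_cst d (T : measurableType d) (f : T -> R) (r : R) :
  measurable_fun setT f -> measurable [set z | f z <= r].
Proof.
move=> mf; rewrite (_ : [set z | _] = f @^-1` `]-oo, r]%classic).
  by rewrite -[X in measurable X]setTI; exact: mf.
by apply/seteqP; split => z /=; rewrite in_itv.
Qed.

Lemma measurable_eball (x : 'rV[R]_n) (r : R) :
  measurable (eball x r : set (borel 'rV[R]_n)).
Proof.
apply: measurable_le_cst.
apply: (@measurable_enorm _ (borel 'rV[R]_n) (fun y => y - x)) => i.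
rewrite (_ : (fun _ => _) = (fun y : borel 'rV[R]_n =>
  (y : 'rV[R]_n) ord0 i - x ord0 i)).
  by apply: measurable_funB => //; exact: measurable_coord.
by apply/funext => y; rewrite !mxE.
Qed.

End Enorm_measurable.

Section Doubling.
Variables (R : realType) (n : nat) (nu : probability (borel 'rV[R]_n) R).

(* A cell is bad if its mass is small compared with the total mass of its
   translates by the offsets.  Each translate of the grid has total mass at
   most 1, so the bad cells have total mass at most (number of offsets) / l. *)
Lemma doubling_exceptional_set (h l : R) (K : nat) : 0 < h -> 0 < l ->
  exists E : set (borel 'rV[R]_n), [/\ measurable E,
    (nu E <= ((2 * K).+1%:R ^+ n / l)%:E)%E &
    forall x, ~ E x ->
      (nu (eball x (K%:R * h)) <= l%:E * nu (eball x (n.+1%:R * h)))%E].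
Proof.
move=> h0 l0.
pose S (a : 'rV[int]_n) : \bar R :=
  (\sum_(f : {ffun 'I_n -> 'I_(2 * K).+1}) nu (cell h (a + offset f)))%E.
pose bad : set 'rV[int]_n := [set a | (l%:E * nu (cell h a) < S a)%E].
have mcell a : measurable (cell h a : set (borel 'rV[R]_n)) by exact:
  measurable_cell.
exists (\bigcup_(a in bad) cell h a); split.
- exact: measurable_countable_bigcup.
- apply: (le_trans (measure_countable_bigcup_le nu bad mcell)).
  apply: (@le_trans _ _ (\esum_(a in bad) (l^-1%:E * S a))%E).
    by apply: le_esum => a bada; rewrite lee_pdivlMl//; exact: ltW.
  apply: (@le_trans _ _ (\esum_(a in [set: 'rV[int]_n]) (l^-1%:E * S a))%E).
    rewrite esum_mkcond; apply: le_esum => a _; case: ifPn => // _.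
    by rewrite mule_ge0 ?lee_fin ?invr_ge0 ?(ltW l0)// sume_ge0.
  have -> : \esum_(a in [set: 'rV[int]_n]) (l^-1%:E * S a)%E =
     (\sum_(f : {ffun 'I_n -> 'I_(2 * K).+1})
       \esum_(a in [set: 'rV[int]_n]) (l^-1%:E * nu (cell h (a + offset f))))%E.
    rewrite -esum_sum; last first.
      by move=> a f _ _; rewrite mule_ge0 ?lee_fin ?invr_ge0 ?(ltW l0).
    by apply: eq_esum => a _; rewrite ge0_sume_distrr.
  apply: (@le_trans _ _ (\sum_(f : {ffun 'I_n -> 'I_(2 * K).+1}) l^-1%:E)%E).
    apply: lee_sum => f _.
    have li0 : 0 <= l^-1 by rewrite invr_ge0 ltW.
    have mf a : measurable (cell h (a + offset f) : set (borel 'rV[R]_n)) by [].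
    have /(measure_countable_bigcup (mscale (NngNum li0) nu) mf) :
        trivIset [set: 'rV[int]_n] (fun a => cell h (a + offset f)).
      by move=> a b _ _ [x [xa xb]]; apply: (@addIr _ (offset f));
        rewrite -xa -xb.
    rewrite /mscale /= => <-; rewrite -[leRHS]mule1 lee_wpmul2l ?lee_fin//.
    by rewrite probability_le1//; exact: measurable_countable_bigcup.
  rewrite sumEFin lee_fin sumr_const card_ffun !card_ord -[leLHS]mulr_natl
    natrX.
  by [].
- move=> x Ex.
  have nbad : ~ bad (grid_index h x).
    by move=> b; apply: Ex; exists (grid_index h x).
  have {nbad} Sle : (S (grid_index h x) <= l%:E * nu (cell h (grid_index h
    x)))%E.
    by rewrite leNgt; apply/negP.
  apply: (@le_trans _ _ (S (grid_index h x))).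
    apply: (@le_trans _ _ (nu (\big[setU/set0]_(f : {ffun 'I_n ->
      'I_(2 * K).+1})
       cell h (grid_index h x + offset f)))).
      apply: le_measure; rewrite ?inE.
      + exact: measurable_eball.
      + by apply: bigsetU_measurable => f _; exact: mcell.
      + move=> y /(grid_index_offset h0)[f yf].
        by rewrite -bigcup_seq; exists f => //; rewrite /= mem_index_enum.
    exact: measure_bigsetU_le.
  apply: (le_trans Sle); rewrite lee_pmul2l//.
  apply: le_measure; rewrite ?inE//; first exact: measurable_eball.
  by move=> y yx; apply: (cell_diam h0 yx).
Qed.

End Doubling.

Section DyadicDoubling.
Variables (R : realType) (n : nat) (nu : probability (borel 'rV[R]_n) R).

Lemma dyad_gt0 j : 0 < dyad R j.
Proof. by rewrite exprn_gt0// invr_gt0. Qed.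

(** With c = 1 + 1/(g - 1) one has c (g - 1) = g, so the right side grows by g^(j+1) >= 1 at each
    step. This absorbs a number j + 1 of scales into an arbitrarily slow exponential. *)
Lemma natS_le_expr (g : R) j : 1 < g ->
  j.+1%:R <= (1 + (g - 1)^-1) * g ^+ j.
Proof.
move=> g1; elim: j => [|j IH].
  by rewrite expr0 mulr1 lerDl invr_ge0 subr_ge0 ltW.
rewrite -natr1 exprS mulrCA -[X in X * _](subrK 1) mulrDl mul1r addrC lerD//.
rewrite mulrA mulrDr mulr1 divff ?subr_eq0 ?gt_eqF// subrK.
by rewrite -exprS exprn_ege1// ltW.
Qed.

(** One factor g^j of the loss pays for the union over the j + 1 values of k; the other leaves a
    bound summable in j. *)
Lemma ae_doubling (g : R) : 1 < g ->
  {ae nu, forall z : 'rV[R]_n, exists J, forall j k, (J <= j)%N -> (k <= j)%N ->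
    (nu (eball z (2 ^+ k * dyad R j)) <=
     ((2 ^+ k) ^+ n * g ^+ (2 * j))%:E * nu (eball z (dyad R j)))%E}.
Proof.
move=> g1; have g0 : 0 < g by exact: lt_trans g1.
(* Cells of this side have diameter at most 2^-j, and [K k] sides make up the radius 2^k 2^-j. *)
pose h (j : nat) : R := dyad R j / n.+1%:R.
pose l (j k : nat) : R := (2 ^+ k) ^+ n * g ^+ (2 * j).
have h0 j : 0 < h j by rewrite divr_gt0 ?dyad_gt0.
have l0 j k : 0 < l j k by rewrite mulr_gt0// !exprn_gt0.
pose K k := (2 ^ k * n.+1)%N.
have /choice[E0 HE0] : forall jk : nat * nat, exists E : set (borel 'rV[R]_n),
  [/\ measurable E,
    (nu E <= ((2 * K jk.2).+1%:R ^+ n / l jk.1 jk.2)%:E)%E &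
    forall x, ~ E x ->
      (nu (eball x ((K jk.2)%:R * h jk.1)) <= (l jk.1 jk.2)%:E * nu (eball x
        (n.+1%:R * h jk.1)))%E].
  by move=> [j k]; exact: doubling_exceptional_set.
pose E j k := E0 (j, k).
have mE j k : measurable (E j k) by have [] := HE0 (j, k).
pose F j := \big[setU/set0]_(k < j.+1) E j k.
(* Since 2 K k + 1 <= (2 (n + 1) + 1) 2^k, the factor (2^k)^n in [l] cancels and the bound on the
   bad cells is uniform in k. *)
pose a : R := (2 * n.+1).+1%:R ^+ n * (1 + (g - 1)^-1).
have a0 : 0 <= a.
  by rewrite mulr_ge0 ?exprn_ge0// addr_ge0// invr_ge0 subr_ge0 ltW.
have gV : 0 < g^-1 < 1 by rewrite invr_gt0 g0 invf_lt1.
have mF j : measurable (F j) by apply: bigsetU_measurable => k _; exact: mE.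
have := @geometric_borel_cantelli _ _ _ nu F a g^-1 a0 gV mF.
have Fle j : (nu (F j) <= (a * g^-1 ^+ j)%:E)%E.
  apply: (le_trans (measure_bigsetU_le nu (index_enum _) (fun k : 'I_j.+1 =>
    mE j k))).
  apply: (@le_trans _ _ (\sum_(k < j.+1) ((2 * n.+1).+1%:R ^+ n / g ^+ (2 *
    j))%:E)%E).
    apply: lee_sum => k _; have [_ + _] := HE0 (j, val k).
    move=> /le_trans; apply; rewrite lee_fin /l /= invfM mulrA ler_pM2r
      ?invr_gt0 ?exprn_gt0//.
    rewrite ler_pdivrMr ?exprn_gt0// -exprMn lerXn2r ?nnegrE ?mulr_ge0
      ?exprn_ge0//.
    rewrite -natrX -natrM ler_nat /K; have := expn_gt0 2 k => /=; nia.
  rewrite sumEFin lee_fin sumr_const card_ord -[leLHS]mulr_natl /a.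
  rewrite mulrCA -mulrA ler_pM2l ?exprn_gt0//.
  rewrite ler_pdivrMr ?exprn_gt0// exprVn -mulrA mulnC exprM expr2 mulKf
    ?expf_neq0 ?gt_eqF//.
  exact: natS_le_expr.
move=> /(_ Fle); apply: filterS => z [J HJ]; exists J => j k Jj kj.
have [_ _ /(_ z)] := HE0 (j, k).
have -> : (K k)%:R * h j = 2 ^+ k * dyad R j.
  by rewrite /K /h natrM natrX -mulrA (mulrC n.+1%:R) divfK.
have -> : n.+1%:R * h j = dyad R j by rewrite /h mulrC divfK.
apply; move=> Ez; apply: (HJ j Jj); rewrite /F -bigcup_mkord.
by exists k.
Qed.

End DyadicDoubling.

(** * Packing dimension and local dimensions *)

Section Dyad.
Variable R : realType.

Lemma dyadS j : dyad R j.+1 = dyad R j / 2.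
Proof. by rewrite /dyad exprS mulrC. Qed.

Lemma le_dyad i j : (i <= j)%N -> dyad R j <= dyad R i.
Proof. by move=> ij; rewrite /dyad ler_wiXn2l// ?invr_ge0// invf_le1//
  ler1n. Qed.

Lemma dyad_le1 j : dyad R j <= 1.
Proof. exact: (@le_dyad 0). Qed.

Lemma dyad_small (e : R) : 0 < e -> exists J, forall j, (J <= j)%N ->
  dyad R j <= e.
Proof.
move=> e0; have : dyad R j @[j --> \oo] --> 0.
  apply: cvg_expr; rewrite ger0_norm ?invr_ge0// invf_lt1// ltr1n//.
move=> /cvgrPdist_le/(_ e e0)[J _ HJ]; exists J => j Jj.
by have := HJ j Jj; rewrite sub0r normrN ger0_norm// ltW// dyad_gt0.
Qed.

Lemma dyad_bracket (r : R) (k : nat) : 0 < r <= dyad R k ->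
  exists2 j, (k <= j)%N & dyad R j <= r < 2 * dyad R j.
Proof.
move=> /andP[r0 rk].
have [J HJ] := dyad_small r0.
have ex : exists j, dyad R j <= r by exists J; exact: HJ.
have := ex_minnP ex => -[j jr jmin].
have [kj|jk] := leqP k j; last first.
  exists k => //; rewrite (le_trans (le_dyad (ltnW jk)) jr)/=.
  by rewrite (le_lt_trans rk)// ltr_pMl ?dyad_gt0// ltr1n.
move: kj; rewrite leq_eqVlt => /predU1P[kj|kj].
  exists k => //; rewrite kj jr/= -kj (le_lt_trans rk)//.
  by rewrite ltr_pMl ?dyad_gt0// ltr1n.
exists j; first exact: ltnW.
rewrite jr/= ltNge; apply/negP => h.
case: j jr jmin kj h => // j jr jmin kj; rewrite dyadS mulrC divfK// => h.
by have := jmin j h; rewrite ltnn.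
Qed.

Lemma powR_exprn (x t : R) j : 0 <= x -> (x ^+ j) `^ t = (x `^ t) ^+ j.
Proof.
move=> x0; elim: j => [|j IH]; first by rewrite !expr0 powR1.
by rewrite !exprS powRM ?exprn_ge0// IH.
Qed.

Lemma half_powR_lt1 (t : R) : 0 < t -> 0 < (2^-1 : R) `^ t < 1.
Proof.
move=> t0; rewrite powR_gt0 ?invr_gt0//=.
have := @gt0_ltr_powR R t t0 2^-1 1; rewrite powR1; apply.
- by rewrite nnegrE invr_ge0.
- by rewrite nnegrE.
- by rewrite invf_lt1// ltr1n.
Qed.

End Dyad.

Lemma esumZl_le (R : realType) (I : choiceType) (D : set I) (a : I ->
  \bar R) (c : R) :
  0 <= c -> (forall i, (0 <= a i)%E) ->
  (\esum_(i in D) (c%:E * a i) <= c%:E * \esum_(i in D) a i)%E.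
Proof.
move=> c0 a0; rewrite ge_ereal_sup => //= _ [X [finX XD] <-].
rewrite fsbig_finite//= -ge0_sume_distrr//; apply: lee_wpmul2l;
  rewrite ?lee_fin//.
by apply: esum_ge; exists X => //; rewrite fsbig_finite.
Qed.


Section PackingNonneg.
Variables (R : realType) (n : nat).

Lemma packing_presum_ge0 s d (A : set 'rV[R]_n) : (0 <= packing_presum s d A)%E.
Proof.
apply: ereal_sup_ubound; exists set0, (fun=> 0), (fun=> 0); split.
  by split; [move=> i []|move=> i j []].
by rewrite esum_set0.
Qed.

Lemma packing_premeasure_ge0 s (A : set 'rV[R]_n) :
  (0 <= packing_premeasure s A)%E.
Proof.
by apply: le_ereal_inf_tmp => _ [d d0 <-]; exact: packing_presum_ge0.
Qed.

End PackingNonneg.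

Section Packing.
Variables (R : realType) (n : nat) (nu : probability (borel 'rV[R]_n) R).

(* Dyadic form of [liminf_(r -> 0) r^-t nu(B(z, r)) = 0], i.e. of "the upper
   local dimension of nu at z is at least t". *)
Definition thin (t : R) (z : 'rV[R]_n) : Prop :=
  forall (e : R) J, 0 < e -> exists2 j, (J <= j)%N &
    (nu (eball z (dyad R j)) < (e * dyad R j `^ t)%:E)%E.

(* Two distinct cells of the same colour are more than one side apart. *)
Definition colour (a : 'rV[int]_n) : {ffun 'I_n -> bool} :=
  [ffun i => odd (absz (a ord0 i))].

Lemma colour_sep a b : colour a = colour b -> a != b ->
  exists i, 2%:Z <= `|a ord0 i - b ord0 i|.
Proof.
move=> ab; have [E|] := pselect (exists i, a ord0 i != b ord0 i); last first.
  move=> N; move=> /eqP[]; apply/rowP => i; apply/eqP/negPn/negP => h.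
  by apply: N; exists i.
move: E => [i abi] _; exists i.
have := congr1 (fun f : {ffun 'I_n -> bool} => f i) ab; rewrite !ffunE; lia.
Qed.

(** Around one chosen point of F in each cell, put a ball of radius h / 2. If two balls met, the
    coordinates of their centres would differ by at most h and the cell indices by at most 1,
    against [colour_sep]. Each ball has diameter h, hence contributes h^s. *)
Lemma packing_cells (s d h : R) (F : set 'rV[R]_n) (D : set 'rV[int]_n) :
  0 < h -> h / 2 <= d -> (forall a, D a -> exists2 x, F x & cell h a x) ->
  (forall a b, D a -> D b -> colour a = colour b) ->
  (\esum_(a in D) (h `^ s)%:E <= packing_presum s d F)%E.
Proof.
move=> h0 hd DF Dc.
pose c (k : nat) : 'rV[R]_n := if pickle_inv k is Some a then
  xget 0 [set x | F x /\ cell h a x] else 0.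
have cE a : D a -> F (c (pickle a)) /\ cell h a (c (pickle a)).
  move=> Da; rewrite /c pickleK_inv; case: xgetP => [x -> //|].
  by have [x Fx ax] := DF _ Da => /(_ x)[].
apply: ereal_sup_ubound; exists (pickle @` D), c, (fun=> h / 2); split.
  split; first by move=> _ [a Da <-]; split; [exact: (cE a Da).1|rewrite
    divr_gt0].
  move=> _ _ [a Da <-] [b Db <-] [x [xa xb]]; apply/eqP/negPn/negP => ab.
  have {}ab : a != b by apply: contra ab => /eqP ->.
  have [i] := colour_sep (Dc _ _ Da Db) ab.
  have [_ <-] := cE _ Da; have [_ <-] := cE _ Db.
  apply/negP; rewrite -ltNge (le_lt_trans (@grid_index_near _ _ _ h0 _ _ _ 1
    _))//.
  rewrite mul1r; move: xa xb; rewrite /eball /=.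
  set u := c _; set v := c _ => xa xb.
  rewrite -[u ord0 i](subrK (x ord0 i)) -addrA (le_trans (ler_normD _ _))//.
  rewrite [leRHS](splitr h) lerD//.
    by rewrite distrC (le_trans _ xa)//; have := coord_le_enorm (x - u) i;
      rewrite !mxE.
  by rewrite (le_trans _ xb)//; have := coord_le_enorm (x - v) i; rewrite !mxE.
rewrite esum_image; last by move=> a b _ _ /(pcan_inj pickleK).
by apply: eq_esum => a _; rewrite mulrC divfK.
Qed.

(* At scale j, the points x of F with nu(B(x, 2^-j)) < 2^(-jt) meet cells which,
   colour by colour, carry a packing; hence there are O(2^(js)) such cells, of
   total mass O(2^(-j(t-s))), and Borel-Cantelli applies. *)
Lemma negligible_thin_packing (s t d : R) (F : set 'rV[R]_n) :
  s < t -> 0 < d -> (packing_presum s d F < +oo)%E ->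
  nu.-negligible [set x : borel 'rV[R]_n | F x /\ thin t x].
Proof.
move=> st d0 Moo.
pose h (j : nat) : R := dyad R j / n.+1%:R.
have h0 j : 0 < h j by rewrite divr_gt0 ?dyad_gt0.
have n0 : (0 : R) < n.+1%:R by [].
pose S j := [set x | F x /\ (nu (eball x (dyad R j)) < (dyad R j `^ t)%:E)%E].
pose D j c := [set a | colour a = c /\ exists2 x, S j x & cell (h j) a x].
pose U j : set (borel 'rV[R]_n) :=
  \big[setU/set0]_(c : {ffun 'I_n -> bool}) \bigcup_(a in D j c) cell (h j) a.
have mcell j a : measurable (cell (h j) a : set (borel 'rV[R]_n)) by exact:
  measurable_cell.
have mUc j c : measurable (\bigcup_(a in D j c) cell (h j) a : set (borel
  'rV[R]_n)).
  exact: measurable_countable_bigcup.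
have mU j : measurable (U j) by apply: bigsetU_measurable => c _; exact: mUc.
have SU j : S j `<=` U j.
  move=> x Sx; rewrite /U -bigcup_seq; exists (colour (grid_index (h j) x)).
    by rewrite /= mem_index_enum.
  by exists (grid_index (h j) x) => //; split => //; exists x.
have [J HJ] := dyad_small d0.
have M0 := packing_presum_ge0 s d F.
pose M := fine (packing_presum s d F).
have ME : packing_presum s d F = M%:E by rewrite fineK// ge0_fin_numE.
have M0' : 0 <= M by rewrite fine_ge0.
pose q : R := 2^-1 `^ (t - s).
have q01 : 0 < q < 1 by rewrite half_powR_lt1// subr_gt0.
pose C : R := n.+1%:R `^ s * M.
have C0 : 0 <= C by rewrite mulr_ge0 ?powR_ge0.
have Uc j c : (J <= j)%N -> (nu (\bigcup_(a in D j c) cell (h j) a) <= (C * q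
  ^+ j)%:E)%E.
  move=> Jj; apply: (le_trans (measure_countable_bigcup_le nu _ (mcell j))).
  (* Chosen so that 2^(-jt) is exactly b (h j)^s: the mass bound of a cell becomes a multiple of its
     term in the packing sum. *)
  pose b := n.+1%:R `^ s * q ^+ j.
  apply: (@le_trans _ _ (\esum_(a in D j c) (b%:E * (h j `^ s)%:E))%E).
    apply: le_esum => a [_ [x [Fx Sx] ax]].
    apply: (@le_trans _ _ (dyad R j `^ t)%:E).
      apply: (le_trans _ (ltW Sx)); apply: le_measure; rewrite ?inE//.
        exact: measurable_eball.
      move=> y ya; have := cell_diam (h0 j) ya ax.
      by rewrite /h mulrC divfK.
    rewrite -EFinM lee_fin /b /q -powR_exprn ?invr_ge0// -/(dyad R j).
    rewrite mulrAC -powRM ?(ltW n0) ?(ltW (h0 j))// /h (mulrC n.+1%:R) divfK//.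
    rewrite -powRD; first by rewrite addrC subrK.
    by apply/implyP => _; rewrite gt_eqF ?dyad_gt0.
  apply: (le_trans (esumZl_le _ _ _)) => //.
  - by rewrite mulr_ge0 ?powR_ge0// exprn_ge0// powR_ge0.
  - by move=> _; rewrite lee_fin powR_ge0.
  rewrite /C mulrAC -/b [leRHS]EFinM lee_wpmul2l//.
    by rewrite lee_fin mulr_ge0 ?powR_ge0// exprn_ge0// powR_ge0.
  rewrite -ME; apply: packing_cells => //.
  - rewrite (le_trans _ (HJ _ Jj))// /h -mulrA ler_piMr ?(ltW (dyad_gt0 _ _))//.
    by rewrite -invfM invf_le1// -natrM ler1n.
  - by move=> a [_ [x [Fx _] ax]]; exists x.
  - by move=> a b' [-> _] [-> _].
pose G j := if (J <= j)%N then U j else set0.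
have mG j : measurable (G j) by rewrite /G; case: ifP.
pose N : R := #|{ffun 'I_n -> bool}|%:R.
have Gle j : (nu (G j) <= ((N * C) * q ^+ j)%:E)%E.
  rewrite /G; case: ifPn => Jj; last first.
    by rewrite measure0 lee_fin !mulr_ge0 ?exprn_ge0 ?powR_ge0.
  apply: (le_trans (measure_bigsetU_le nu (index_enum _) (mUc j))).
  apply: (@le_trans _ _ (\sum_(c : {ffun 'I_n -> bool}) (C * q ^+ j)%:E)%E).
    by apply: lee_sum => c _; exact: Uc.
  by rewrite sumEFin lee_fin sumr_const -[leLHS]mulr_natl mulrA.
have := geometric_borel_cantelli _ q01 mG Gle.
move=> /(_ (mulr_ge0 (ler0n _ _) C0)).
apply: negligibleS => x [Fx tx] [J' HJ'].
have [j] := tx 1 (maxn J J') ltr01; rewrite geq_max => /andP[Jj J'j].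
rewrite mul1r => nux; apply: (HJ' j J'j); rewrite /G Jj.
by apply: SU.
Qed.

End Packing.

Section PackingDim.
Variables (R : realType) (n : nat) (nu : probability (borel 'rV[R]_n) R).

(** Finiteness of the two infima yields a countable cover of A in which each piece has a finite
    packing sum at some scale d. *)
Lemma packing_measure_fin_negligible (s t : R) (A : set 'rV[R]_n) :
  s < t -> (packing_measure s A < +oo)%E ->
  nu.-negligible [set x : borel 'rV[R]_n | A x /\ thin nu t x].
Proof.
move=> st /ereal_inf_lt[_ [F AF <-]] Foo.
suff : nu.-negligible (\bigcup_i [set x : borel 'rV[R]_n | F i x /\ thin nu t
  x]).
  by apply: negligibleS => x [/AF[i _ Fix] tx]; exists i.
apply: negligible_bigcup => i.
have p0 k := packing_premeasure_ge0 s (F k).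
have : (packing_premeasure s (F i) < +oo)%E.
  apply: le_lt_trans Foo; rewrite nneseries_esumT//.
  apply: esum_ge; exists [set i]; last by rewrite fsbig_set1.
  by split.
move=> /ereal_inf_lt[_ [d d0 <-]] doo.
exact: negligible_thin_packing doo.
Qed.

(** If a set has zero s-dimensional packing measure with s < m, then its points that are thin at the
    midpoint of s and m form a null set; since almost every point is thin there, the set itself is
    null. *)
Lemma packing_dim_measure_ge (m : R) :
  (forall t, t < m -> {ae nu, forall z : 'rV[R]_n, thin nu t z}) ->
  (m%:E <= packing_dim_measure nu)%E.
Proof.
move=> thn; apply: le_ereal_inf_tmp => _ [A [mA A0] <-].
apply: le_ereal_inf_tmp => _ [s [s0 sA] <-].
rewrite lee_fin leNgt; apply/negP => sm.
have st : s < (s + m) / 2 by lra.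
have tm : (s + m) / 2 < m by lra.
have : (packing_measure s A < +oo)%E by rewrite sA.
move=> /(packing_measure_fin_negligible st) An.
have : nu.-negligible A.
  apply: (negligibleS _ (negligibleU An (thn _ tm))) => x Ax.
  by have [tx|ntx] := pselect (thin nu ((s + m) / 2) x); [left|right].
by move=> /(measure_negligible mA) A0'; rewrite A0' ltxx in A0.
Qed.

Lemma measurable_fun_measure_eball (r : R) :
  measurable_fun setT (fun z : borel 'rV[R]_n => nu (eball z r)).
Proof.
pose A : set (borel 'rV[R]_n * borel 'rV[R]_n) :=
  [set zy | enorm ((zy.2 : 'rV[R]_n) - zy.1) <= r].
have mA : measurable A.
  apply: measurable_le_cst; apply: measurable_enorm => i.
  rewrite (_ : (fun _ => _) = (fun zy : borel 'rV[R]_n * borel 'rV[R]_n =>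
     (zy.2 : 'rV[R]_n) ord0 i - (zy.1 : 'rV[R]_n) ord0 i)); last first.
    by apply/funext => zy; rewrite !mxE.
  apply: measurable_funB.
    exact: (measurableT_comp (measurable_coord i) measurable_snd).
  exact: (measurableT_comp (measurable_coord i) measurable_fst).
rewrite (_ : (fun z => _) = nu \o xsection A);
  first exact: measurable_fun_xsection.
apply/funext => z /=; congr (nu _).
by apply/seteqP; split => y; rewrite /xsection /= inE.
Qed.

(** At a point that is not thin, balls have mass at least a constant times 2^(-jt). On such points a
    packing by small balls has (t + e)-sum at most a small multiple of the total mass of disjoint
    balls, so the (t + e)-premeasure vanishes. *)
Lemma packing_dim_measure_le (t : R) : 0 <= t ->
  ~ {ae nu, forall z : 'rV[R]_n, thin nu t z} ->
  (packing_dim_measure nu <= t%:E)%E.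
Proof.
move=> t0 nthin.
(* A single index k fixes both the constant 1 / (k + 1) and the first scale from which the lower
   bound holds. *)
pose A (k : nat) : set (borel 'rV[R]_n) := \bigcap_(j in [set j | (k <= j)%N])
  [set z | ((k.+1%:R^-1 * dyad R j `^ t)%:E <= nu (eball z (dyad R j)))%E].
have mA k : measurable (A k).
  apply: bigcap_measurable; first by exists k => /=.
  move=> j _; rewrite -[X in measurable X]setTI.
  apply: emeasurable_fun_c_infty => //; exact: measurable_fun_measure_eball.
have nthinE : [set z | ~ thin nu t z] `<=` \bigcup_k A k.
  move=> z /= nz; apply: contrapT => nA; apply: nz => e J e0;
    apply: contrapT => nj.
  have [k kJ ke] : exists2 k, (J <= k)%N & k.+1%:R^-1 <= e.
    have [k ke] : exists k, e^-1 <= k.+1%:R.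
      exists (Num.truncn e^-1); have := truncnS_gt e^-1; rewrite ?num_real//.
      exact: ltW.
    exists (maxn J k); first exact: leq_maxl.
    rewrite invf_ple ?posrE// (le_trans ke)// ler_nat ltnS; exact: leq_maxr.
  apply: nA; exists k => // j /= kj; rewrite leNgt; apply/negP => lt.
  apply: nj; exists j; first exact: leq_trans kj.
  by apply: (lt_le_trans lt); rewrite lee_fin ler_wpM2r// powR_ge0.
have mUA : measurable (\bigcup_k A k) by exact: bigcupT_measurable.
have UA0 : (0 < nu (\bigcup_k A k))%E.
  rewrite lt0e measure_ge0 andbT; apply/eqP => UA0; apply: nthin.
  have : nu.-negligible (\bigcup_k A k) by exact/negligibleP.
  exact: negligibleS.
apply: (@le_trans _ _ (packing_dim (\bigcup_k A k))).
  by apply: ereal_inf_lbound; exists (\bigcup_k A k).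
apply/lee_addgt0Pr => e e0.
apply: ereal_inf_lbound; exists (t + e) => //; split;
  first by rewrite addr_ge0// ltW.
apply/eqP; rewrite eq_le; apply/andP; split; last first.
  apply: le_ereal_inf_tmp => _ [F _ <-]; apply: nneseries_ge0 => k _ _.
  exact: packing_premeasure_ge0.
apply: (@le_trans _ _ (\sum_(0 <= k <oo) packing_premeasure (t + e) (A k))%E).
  by apply: ereal_inf_lbound; exists A.
rewrite eseries0// => k _ _; apply/eqP; rewrite eq_le; apply/andP; split;
  last first.
  exact: packing_premeasure_ge0.
apply/lee_addgt0Pr => eta eta0; rewrite add0e.
(* The factor 4^t comes from 2 r < 4 2^-j, where 2^-j <= r < 2 2^-j; the factor k + 1 inverts the
   mass bound on [A k]. *)
pose C : R := 4 `^ t * k.+1%:R.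
have C0 : 0 < C by rewrite mulr_gt0// powR_gt0.
(* d1 is chosen so that [(2 * d1) `^ e = eta / C]. *)
pose d1 : R := (eta / C) `^ e^-1 / 2.
have d10 : 0 < d1 by rewrite divr_gt0// powR_gt0// divr_gt0.
pose d := Num.min d1 (dyad R k).
have d0 : 0 < d by rewrite lt_min d10 dyad_gt0.
apply: (@le_trans _ _ (packing_presum (t + e) d (A k))).
  by apply: ereal_inf_lbound; exists d.
apply: ge_ereal_sup => _ [I [c [r [[Ic tI] ->]]]].
apply: (@le_trans _ _ (\esum_(i in I) (eta%:E * nu (eball (c i) (r i))))%E).
  apply: le_esum => i Ii; have [Aci /andP[ri0 rid]] := Ic i Ii.
  have rk : 0 < r i <= dyad R k.
    by rewrite ri0 (le_trans rid)// /d ge_min lexx orbT.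
  have [j kj /andP[jr rj]] := dyad_bracket rk.
  apply: (@le_trans _ _ (eta%:E * nu (eball (c i) (dyad R j)))%E); last first.
    apply: lee_wpmul2l; first by rewrite lee_fin ltW.
    apply: le_measure; rewrite ?inE; [exact: measurable_eball|exact:
      measurable_eball|].
    by move=> y /= /le_trans; exact.
  apply: (@le_trans _ _ (eta%:E * (k.+1%:R^-1 * dyad R j `^ t)%:E)%E);
    last first.
    by apply: lee_wpmul2l; [rewrite lee_fin ltW|exact: Aci].
  rewrite -EFinM lee_fin powRD; last by apply/implyP => _;
    rewrite gt_eqF ?mulr_gt0.
  have -> : eta * (k.+1%:R^-1 * dyad R j `^ t) = (4 * dyad R j) `^ t * (eta /
    C).
    rewrite powRM ?(ltW (dyad_gt0 _ _))// /C invfM.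
    by field; rewrite !gt_eqF ?powR_gt0.
  apply: ler_pM; rewrite ?powR_ge0//.
    apply: ge0_ler_powR => //; rewrite ?nnegrE ?mulr_ge0 ?(ltW ri0) ?(ltW
      (dyad_gt0 _ _))//.
    by have := dyad_gt0 R j; lra.
  apply: (@le_trans _ _ ((2 * d1) `^ e)).
    apply: ge0_ler_powR; rewrite ?nnegrE ?mulr_ge0 ?(ltW ri0) ?(ltW e0) ?(ltW
      d10)//.
      exact: powR_ge0.
    by rewrite ler_pM2l// (le_trans rid)// /d ge_min lexx.
  by rewrite /d1 mulrC divfK// -powRrM mulVf ?gt_eqF// powRr1// divr_ge0//
    ltW//.
apply: (le_trans (esumZl_le _ (ltW eta0) _)) => //.
rewrite -measure_countable_bigcup//; last by move=> i; exact: measurable_eball.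
rewrite -[leRHS]mule1 lee_wpmul2l ?lee_fin ?(ltW eta0)// probability_le1//.
by apply: measurable_countable_bigcup => i; exact: measurable_eball.
Qed.

End PackingDim.

(** * Orthogonal projections and the Grassmannian *)

Lemma enorm_mulmx (R : realType) n (x : 'rV[R]_n) : (x *m x^T) 0 0 = enorm x ^+
  2.
Proof.
by rewrite enorm_sqr mxE; apply: eq_bigr => i _; rewrite mxE expr2.
Qed.

Section Orthonormal.
Variables (R : realType) (n : nat).
Implicit Types (V W : {vspace 'rV[R]_n}) (x y v : 'rV[R]_n).

Lemma mulmx_trC x y : x *m y^T = y *m x^T.
Proof.
by apply/matrixP => i j; rewrite !ord1 !mxE; apply: eq_bigr => k _;
  rewrite !mxE mulrC.
Qed.

Lemma enorm_pythagoras x y : x *m y^T = 0 ->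
  enorm (x + y) ^+ 2 = enorm x ^+ 2 + enorm y ^+ 2.
Proof.
move=> xy; rewrite -!enorm_mulmx linearD /= mulmxDr !mulmxDl xy.
by rewrite (mulmx_trC y) xy addr0 add0r mxE.
Qed.

Definition orthonormal_in k W (B : 'M[R]_(k, n)) : Prop :=
  B *m B^T = 1%:M /\ forall c : 'rV[R]_k, c *m B \in W.

(** Induction on k: the map x -> x B^T sends W to a space of dimension at most k, so when k < dim W
    its kernel in W contains a nonzero vector, which is normalised and added as a new row. *)
Lemma orthonormal_inP k W : (k <= \dim W)%N ->
  exists B : 'M[R]_(k, n), orthonormal_in W B.
Proof.
elim: k => [_|k IH kW].
  exists 0; split; first by apply/matrixP => -[].
  by move=> c; rewrite mulmx0 mem0v.
have [B [BB BW]] := IH (ltnW kW).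
pose f : 'Hom('rV[R]_n, 'rV[R]_k) := linfun (mulmxr B^T).
pose U := (W :&: lker f)%VS.
have U0 : U != 0%VS.
  rewrite -dimv_eq0 -lt0n; have := limg_ker_dim f W; rewrite -/U.
  have : (\dim (f @: W) <= k)%N.
    by rewrite (leq_trans (dimvS (subvf _)))// dimvf /dim /= mul1n.
  move=> + dimE; rewrite -dimE in kW.
  by rewrite -(leq_add2l (\dim U)) => /(leq_trans kW);
    rewrite -[X in (X <= _)%N]add1n leq_add2r.
pose v := vpick U.
have v0 : v != 0 by rewrite vpick0.
have : v \in U by exact: memv_pick.
rewrite memv_cap memv_ker lfunE /= => /andP[vW /eqP vB].
have ev0 : enorm v != 0 by rewrite enorm_eq0.
pose u := (enorm v)^-1 *: v.
have uW : u \in W by rewrite memvZ.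
have uB : u *m B^T = 0 by rewrite -scalemxAl vB scaler0.
have uu : u *m u^T = 1%:M.
  apply/matrixP => i j; rewrite !ord1 enorm_mulmx enormZ ger0_norm ?invr_ge0
    ?enorm_ge0//.
  by rewrite mulVf// expr1n mxE.
suff uBW : orthonormal_in W (col_mx u B) by exists (col_mx u B).
split.
  rewrite tr_col_mx mul_col_row uu uB BB.
  have -> : B *m u^T = 0 by rewrite -[LHS]trmxK trmx_mul trmxK uB trmx0.
  by rewrite -scalar_mx_block.
move=> c; rewrite -[c]hsubmxK mul_row_col memvD//.
by rewrite [lsubmx c]mx11_scalar mul_scalar_mx memvZ.
Qed.

Section Basis.
Variables (W : {vspace 'rV[R]_n}) (B : 'M[R]_(\dim W, n)).
Hypothesis BW : orthonormal_in W B.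

(** The map x -> x B^T is onto R^(dim W) already on W, hence injective on W by dimension count, and
    it sends both sides to the same vector. *)
Lemma orthonormal_decomp x : x \in W -> x = x *m B^T *m B.
Proof using BW.
have [BB BinW] := BW.
pose f : 'Hom('rV[R]_n, 'rV[R]_(\dim W)) := linfun (mulmxr B^T).
have fW : (f @: W)%VS = fullv.
  apply/eqP; rewrite eqEsubv subvf; apply/subvP => c _.
  apply/memv_imgP; exists (c *m B) => //.
  by rewrite lfunE /= -mulmxA BB mulmx1.
have /eqP := limg_ker_dim f W; rewrite fW dimvf /dim /= mul1n.
rewrite -[X in _ == X]add0n eqn_add2r dimv_eq0 => /eqP ker0 xW.
apply/eqP; rewrite -subr_eq0 -memv0 -ker0 memv_cap memvB//= memv_ker lfunE /=.
by rewrite mulmxBl -(mulmxA _ B) BB mulmx1 subrr.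
Qed.

Lemma enorm_orthonormal x : x \in W -> enorm x = enorm (x *m B^T).
Proof using BW.
have [BB BinW] := BW => xW.
apply/eqP; rewrite -(eqrXn2 (n := 2))// ?enorm_ge0// -!enorm_mulmx.
rewrite {1}(orthonormal_decomp xW) trmx_mul trmxK.
by rewrite !mulmxA.
Qed.

End Basis.

Lemma orthprojB V x y : orthproj V (x - y) = orthproj V x - orthproj V y.
Proof. exact: raddfB. Qed.

Lemma orthprojZ V (c : R) x : orthproj V (c *: x) = c *: orthproj V x.
Proof. exact: linearZ. Qed.

Lemma orthproj_sub V x : x - orthproj V x \in orthv V.
Proof. by apply/orthvP => v vV; exact: orthproj_orth. Qed.

Lemma enorm_orthproj_decomp V x :
  enorm x ^+ 2 = enorm (orthproj V x) ^+ 2 + enorm (x - orthproj V x) ^+ 2.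
Proof.
rewrite -enorm_pythagoras; first by rewrite addrCA subrr addr0.
by rewrite mulmx_trC orthproj_orth ?orthproj_mem.
Qed.

Lemma enorm_orthproj_le V x : enorm (orthproj V x) <= enorm x.
Proof.
rewrite -(ler_pXn2r (n := 2))// ?nnegrE ?enorm_ge0//.
by rewrite (enorm_orthproj_decomp V x) lerDl sqr_ge0.
Qed.

Lemma orthproj_uniq V x y : y \in V -> x - y \in orthv V -> orthproj V x = y.
Proof.
move=> yV xyV; apply/eqP; rewrite -subr_eq0 -memv0 -(capv_orthv V) memv_cap.
rewrite memvB ?orthproj_mem//=.
have -> : orthproj V x - y = (x - y) - (x - orthproj V x) by rewrite opprB
  [RHS]addrC addrA subrK.
by rewrite memvB// orthproj_sub.
Qed.

Lemma dim_orthv V : \dim (orthv V) = (n - \dim V)%N.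
Proof.
have := dimv_disjoint_sum (capv_orthv V).
rewrite addv_orthv dimvf /dim /= mul1n; lia.
Qed.

Lemma enorm_orthproj_basis V (B : 'M[R]_(\dim V, n)) x : orthonormal_in V B ->
  enorm (orthproj V x) = enorm (x *m B^T).
Proof.
move=> BV; rewrite (enorm_orthonormal BV) ?orthproj_mem//; congr enorm.
apply/eqP; rewrite -subr_eq0 -mulmxBl; apply/eqP/trmx_inj.
rewrite trmx0 trmx_mul trmxK; apply/row_matrixP => i; rewrite row_mul row0.
rewrite mulmx_trC -[LHS]opprK -mulNmx opprB orthproj_orth ?oppr0//.
by rewrite rowE; exact: BV.2.
Qed.

Lemma enorm_orthv_basis V (B : 'M[R]_(\dim (orthv V), n)) x :
  orthonormal_in (orthv V) B ->
  enorm (x - orthproj V x) = enorm (x *m B^T).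
Proof.
move=> BV; rewrite (enorm_orthonormal BV) ?orthproj_sub//; congr enorm.
rewrite mulmxBl -[RHS]subr0; congr (_ - _); apply: trmx_inj.
rewrite trmx0 trmx_mul trmxK; apply/row_matrixP => i; rewrite row_mul row0.
by have /orthvP -> // : row i B \in orthv V; [rewrite rowE;
  exact: BV.2|exact: orthproj_mem].
Qed.

End Orthonormal.

(** * Lattice points near a subspace *)

Section GridCount.
Variables (R : realType) (n : nat).
Implicit Types (V : {vspace 'rV[R]_n}).

Definition grid_point M (f : {ffun 'I_n -> 'I_M}) : 'rV[R]_n :=
  \row_i (f i).+1%:R.

Lemma enorm_grid_point M (f : {ffun 'I_n -> 'I_M}) :
  enorm (grid_point f) <= (n.+1 * M)%:R.
Proof.
rewrite natrM; apply: enorm_le_coord => // i; rewrite mxE ger0_norm// ler_nat.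
exact: ltn_ord.
Qed.

(** The index of the unit cell containing x. The shift by N makes the coordinates nonnegative, so
    that truncation is the floor. *)
Definition code k N (x : 'rV[R]_k) : {ffun 'I_k -> 'I_(2 * N).+1} :=
  [ffun i => inord (Num.truncn (x ord0 i + N%:R))].

(* [enorm x <= N] keeps the truncated value in range of [inord]. *)
Lemma code_inj k N (x y : 'rV[R]_k) : enorm x <= N%:R -> enorm y <= N%:R ->
  code N x = code N y -> enorm (x - y) <= k.+1%:R.
Proof.
move=> xN yN xy; rewrite -[leRHS]mulr1; apply: enorm_le_coord => // i;
  rewrite !mxE.
have /(congr1 val) := congr1 (fun f : {ffun 'I_k -> 'I_(2 * N).+1} => f i) xy.
rewrite !ffunE /=.
have bnd (z : 'rV[R]_k) : enorm z <= N%:R ->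
   (Num.truncn (z ord0 i + N%:R) < (2 * N).+1)%N /\ 0 <= z ord0 i + N%:R.
  move=> zN; have := le_trans (coord_le_enorm z i) zN;
    rewrite ler_norml => /andP[z1 z2].
  have z0 : 0 <= z ord0 i + N%:R by lra.
  have /andP[h _] := truncn_itv z0.
  split => //; rewrite ltnS -(ler_nat R) (le_trans h)//.
  by rewrite natrM; lra.
have [xb x0] := bnd _ xN; have [yb y0] := bnd _ yN.
rewrite !inordK// => E.
have := truncn_itv x0; have := truncn_itv y0; rewrite E -natr1.
by rewrite ler_norml => /andP[? ?] /andP[? ?]; apply/andP; split; lra.
Qed.

(* A grid point near V^perp is determined by its unit cell in V, where boundedly
   many cells are available, its unit cell in V^perp, where O(M^(n-m)) are, and
   its coordinates modulo a constant exceeding the diameter of a product cell.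
     *)
Lemma grid_count (m K : nat) : exists C : nat, forall M V, (0 < M)%N ->
  \dim V = m ->
  (#|[pred f : {ffun 'I_n -> 'I_M} | (enorm (orthproj V (grid_point f)) <=
    K%:R)%R]|
    <= C * M ^ (n - m))%N.
Proof.
(* Two points sharing their unit cells in V and in V^perp are at squared distance at most 2 (n +
   1)^2, hence at distance at most L; residues modulo L + 1 then separate them. *)
pose L := (2 * n.+1)%N.
exists ((2 * K).+1 ^ m * (2 * n.+1).+1 ^ (n - m) * L.+1 ^ n)%N => M V M0 dV.
have [B BV] := orthonormal_inP (leqnn (\dim V)).
have [B' BV'] := orthonormal_inP (leqnn (\dim (orthv V))).
pose z (f : {ffun 'I_n -> 'I_M}) : 'rV[R]_n := grid_point f.
pose N := (n.+1 * M)%N.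
pose e (f : {ffun 'I_n -> 'I_M}) :=
  (code K (z f *m B^T), code N (z f *m B'^T),
   [ffun i => inord (f i %% L.+1)] : {ffun 'I_n -> 'I_L.+1}).
set A := [pred f | _].
have zN f : enorm (z f *m B'^T) <= N%:R.
  rewrite -enorm_orthv_basis// (le_trans _ (enorm_grid_point f))//.
  rewrite -(ler_pXn2r (n := 2))// ?nnegrE ?enorm_ge0//.
  by rewrite (enorm_orthproj_decomp V (grid_point f)) lerDr sqr_ge0.
have einj : {in A &, injective e}.
  move=> f g; rewrite !inE => fA gA [e1 e2 e3].
  rewrite -/(z _) (enorm_orthproj_basis _ BV) in fA.
  rewrite -/(z _) (enorm_orthproj_basis _ BV) in gA.
  have := code_inj fA gA e1; have := code_inj (zN f) (zN g) e2.
  rewrite -!mulmxBl -(enorm_orthproj_basis _ BV) -(enorm_orthv_basis _ BV') =>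
    h2 h1.
  have dn : (\dim V <= n)%N.
    by have := dimvS (subvf V); rewrite dimvf /dim /= mul1n.
  have h : enorm (z f - z g) <= L%:R.
    rewrite -(ler_pXn2r (n := 2))// ?nnegrE ?enorm_ge0//
      (enorm_orthproj_decomp V).
    rewrite (@le_trans _ _ (n.+1%:R ^+ 2 + n.+1%:R ^+ 2))//.
      rewrite lerD// ler_pXn2r// ?nnegrE ?enorm_ge0//.
        by rewrite (le_trans h1)// ler_nat.
      by rewrite (le_trans h2)// ler_nat ltnS dim_orthv leq_subr.
    by rewrite -!natrX -natrD ler_nat /L; nia.
  apply/ffunP => i; apply: val_inj => /=.
  have := le_trans (coord_le_enorm _ i) h; rewrite !mxE => {}h.
  have {}h : `|(f i : nat)%:Z - (g i : nat)%:Z| <= L%:Z.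
    rewrite -(ler_int R) intr_norm intrB -!pmulrn; move: h.
    by rewrite -(@natr1 _ (f i)) -(@natr1 _ (g i)) opprD addrACA subrr addr0.
  have /(congr1 val) := congr1 (fun f : {ffun 'I_n -> 'I_L.+1} => f i) e3.
  rewrite !ffunE /= !inordK ?ltn_pmod// => fg.
  move: h fg; move: (nat_of_ord (f i)) (nat_of_ord (g i)) => a b.
  wlog ab : a b / (a <= b)%N.
    move=> H; case: (leqP a b) => [|/ltnW] ab h fg; first exact: H.
    by apply/esym; apply: H => //; rewrite distrC.
  move=> h fg; have : (L.+1 %| b - a)%N by rewrite -eqn_mod_dvd// fg.
  move=> /dvdnP[[|k] kE]; first lia.
  have Lab : (L.+1 <= b - a)%N by rewrite kE leq_pmull.
  by clear -h Lab; lia.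
rewrite -(card_in_imset einj) (leq_trans (max_card _))//.
rewrite !card_prod !card_ffun !card_ord dim_orthv dV.
rewrite [X in (_ <= X)%N]mulnAC leq_mul2r; apply/orP; right.
rewrite -[X in (_ <= X)%N]mulnA leq_mul2l; apply/orP; right.
rewrite -expnMn; case: (n - m)%N => [//|k]; rewrite leq_exp2r//.
nia.
Qed.

End GridCount.

Section Householder.
Variables (R : realType) (n : nat).
Implicit Types (x y : 'rV[R]_n).

Lemma exists_orthogonal_mx x y : enorm x = enorm y ->
  exists2 U : 'M[R]_n, U *m U^T = 1%:M & x *m U = y.
Proof.
move=> xy; have [->|xny] := eqVneq x y; first by exists 1%:M;
  rewrite ?trmx1 mulmx1.
pose w := x - y.
have w0 : enorm w != 0 by rewrite enorm_eq0 subr_eq0.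
pose N := enorm w ^+ 2.
have N0 : N != 0 by rewrite expf_neq0.
have wwE : w *m w^T = N%:M.
  by apply/matrixP => i j; rewrite !ord1 enorm_mulmx mxE.
have xwE : x *m w^T = (N / 2)%:M.
  have e : x *m y^T = y *m x^T by exact: mulmx_trC.
  have xx : x *m x^T = y *m y^T.
    by apply/matrixP => i j; rewrite !ord1 !enorm_mulmx xy.
  have : w *m w^T = (x *m w^T) *+ 2.
    rewrite /w linearB /= !mulmxBl !mulmxBr -xx e mulr2n opprB.
    by rewrite addrC.
  rewrite wwE => wx; rewrite -[LHS](@scalerK _ _ 2)//.
  by rewrite scaler_nat -wx scale_scalar_mx mulrC.
(* The Householder reflection exchanging x and y. *)
exists (1%:M - (2 / N) *: (w^T *m w)); last first.
  rewrite mulmxBr mulmx1 -scalemxAr mulmxA xwE mul_scalar_mx scalerA.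
  by rewrite (_ : 2 / N * (N / 2) = 1) ?scale1r ?subKr//; field.
have -> : (1%:M - (2 / N) *: (w^T *m w))^T = 1%:M - (2 / N) *: (w^T *m w).
  by rewrite linearB linearZ /= trmx1 trmx_mul trmxK.
rewrite mulmxBr mulmx1 mulmxBl mul1mx.
rewrite -scalemxAl -scalemxAr mulmxA -(mulmxA _ w w^T) wwE mul_mx_scalar
  -scalemxAl.
rewrite [X in _ - (_ - X)](_ : _ = (2 / N) *: (w^T *m w) + (2 / N) *: (w^T *m
  w)).
  by rewrite opprB addrK subrK.
by rewrite !scalerA -scalerDl; congr (_ *: _); field.
Qed.

End Householder.

Section GrassmannMeasure.
Variables (R : realType) (n m : nat) (le_mn : (m <= n)%N).
Variable gamma : probability (borel (grassmann R le_mn)) R.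
Implicit Types (x y z : 'rV[R]_n) (V W : {vspace 'rV[R]_n}).

Lemma measurable_grassmann_mx i j :
  measurable_fun setT (fun V : borel (grassmann R le_mn) =>
    grassmann_mx (V : grassmann R le_mn) i j).
Proof.
have cf : continuous (fun V : grassmann R le_mn => grassmann_mx V i j).
  move=> V; apply: (@continuous_comp _ _ _ (@grassmann_mx R n m le_mn) (fun M :
    'M[R]_n => M i j)).
    exact: initial_continuous.
  exact: coord_continuous.
have := @continuous_borel_measurable R (grassmann R le_mn) _ cf.
exact.
Qed.

Lemma orthproj_grassmann_mx (V : grassmann R le_mn) x :
  orthproj (sval V) x = x *m grassmann_mx V.
Proof. by rewrite /grassmann_mx /orthproj mul_rV_lin1. Qed.

Definition small_proj (x : 'rV[R]_n) (r : R) : set (borel (grassmann R le_mn))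
  :=
  [set V | enorm (orthproj (sval V) x) <= r].

Lemma measurable_small_proj x r : measurable (small_proj x r).
Proof.
apply: measurable_le_cst; apply: measurable_enorm => i.
rewrite (_ : (fun _ => _) = (fun V : borel (grassmann R le_mn) =>
  \sum_j x ord0 j * grassmann_mx (V : grassmann R le_mn) j i)); last first.
  by apply/funext => V; rewrite orthproj_grassmann_mx mxE.
apply: measurable_sum => j; apply: measurable_funM => //.
exact: measurable_grassmann_mx.
Qed.

Hypothesis gamma_rot : rotation_invariant gamma.

Lemma enorm_orthogonal (U : 'M[R]_n) x : U *m U^T = 1%:M ->
  enorm (x *m U) = enorm x.
Proof.
move=> UU; apply/eqP; rewrite -(eqrXn2 (n := 2))// ?enorm_ge0// -!enorm_mulmx.
by rewrite trmx_mul -mulmxA (mulmxA U) UU mul1mx.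
Qed.

Lemma orthproj_orthogonal (U : 'M[R]_n) V x : U *m U^T = 1%:M ->
  orthproj (linfun (mulmxr U) @: V) (x *m U) = orthproj V x *m U.
Proof.
move=> UU; apply: orthproj_uniq.
  by apply/memv_imgP; exists (orthproj V x); rewrite ?orthproj_mem// lfunE.
apply/orthvP => _ /memv_imgP[v vV ->]; rewrite lfunE /= -mulmxBl trmx_mul.
by rewrite mulmxA -(mulmxA _ U) UU mulmx1 orthproj_orth.
Qed.

Lemma small_proj_orthogonal (U : 'M[R]_n) x r : U *m U^T = 1%:M ->
  gamma (small_proj (x *m U) r) = gamma (small_proj x r).
Proof using gamma_rot.
move=> UU; rewrite -(gamma_rot UU (measurable_small_proj x r)); congr (gamma _).
have UU' : U^T *m U = 1%:M by exact: mulmx1C.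
apply/seteqP; split => W /=; rewrite /small_proj /=; last first.
  by move=> [V Vx ->]; rewrite orthproj_orthogonal// enorm_orthogonal.
move=> Wx; pose V := (linfun (mulmxr U^T) @: sval W)%VS.
have WE : sval W = (linfun (mulmxr U) @: V)%VS.
  rewrite /V -limg_comp; apply/esym; rewrite -[RHS]lim1g;
    apply: eq_in_limg => v _.
  by rewrite comp_lfunE !lfunE /= -mulmxA UU' mulmx1.
(* Rank-nullity for U^T on W gives dim V <= m, and for U on V gives m <= dim V. *)
have dV : \dim V == m.
  have := limg_ker_dim (linfun (mulmxr U)) V; rewrite -WE.
  have := limg_ker_dim (linfun (mulmxr U^T)) (sval W); rewrite -/V.
  have /eqP -> := svalP W.
  by move=> h1 h2; apply/eqP; move: h1 h2; set a := \dim _; set b := \dim _;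
    set c := \dim _; lia.
exists (exist _ V dV) => //=.
by move: Wx; rewrite WE orthproj_orthogonal// enorm_orthogonal.
Qed.

(** Rescaling x to the length of z multiplies the radius by the same factor; an orthogonal matrix
    then carries one vector to the other. *)
Lemma small_proj_scale x z r : x != 0 -> z != 0 -> 
  gamma (small_proj x r) = gamma (small_proj z (r * (enorm z / enorm x))).
Proof using gamma_rot.
move=> x0 z0.
have ex0 : 0 < enorm x by rewrite lt0r enorm_eq0 x0 enorm_ge0.
have ez0 : 0 < enorm z by rewrite lt0r enorm_eq0 z0 enorm_ge0.
have c0 : 0 < enorm z / enorm x by rewrite divr_gt0.
have [|U UU xU] := @exists_orthogonal_mx R n ((enorm z / enorm x) *: x) z.
  by rewrite enormZ gtr0_norm// divfK// gt_eqF.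
transitivity (gamma (small_proj ((enorm z / enorm x) *: x) (r * (enorm z /
  enorm x)))).
  2: by rewrite -(small_proj_orthogonal _ _ UU) xU.
congr (gamma _).
apply/seteqP; split => V; rewrite /small_proj /= orthprojZ enormZ gtr0_norm//
  (mulrC (enorm z / enorm x)) ler_pM2r//.
Qed.

(* By rotation invariance the measure depends only on r / |x|; averaging it over
   the grid {1, ..., M}^n with M close to |x| / r reduces it to the uniform
     count
   of grid points with bounded projection to V. *)
Lemma small_proj_le : exists C : R, 0 <= C /\ forall x r, 0 < r ->
  (gamma (small_proj x r) <= (C * (r / Num.max r (enorm x)) ^+ m)%:E)%E.
Proof using gamma_rot.
have [C HC] := @grid_count R n m (2 * n.+1).
(* The summand 1 covers the range |x| <= r, where the bound must reach the total mass. *)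
pose C' : R := C%:R + 1.
exists C'; split => [|x r r0]; first by rewrite addr_ge0.
have [xr|rx] := leP (enorm x) r.
  rewrite divff ?gt_eqF// expr1n mulr1 (le_trans (probability_le1 _ _))//.
    exact: measurable_small_proj.
  by rewrite lee_fin lerDr.
have ex0 : 0 < enorm x by exact: lt_trans rx.
have x0 : x != 0 by rewrite -enorm_eq0 gt_eqF.
pose rho := r / enorm x.
have rho0 : 0 < rho by rewrite divr_gt0.
have rho1 : rho < 1 by rewrite ltr_pdivrMr// mul1r.
(* Two bounds are needed: rho M <= 2 keeps the rescaled radii below 2 (n + 1), and M >= 1 / rho
   turns the final M^(-m) into rho^m. *)
pose M := (Num.truncn rho^-1).+1.
have /andP[M1 M2] : M%:R - 1 <= rho^-1 < M%:R.
  have := truncn_itv (ltW (_ : 0 < rho^-1)); rewrite invr_gt0 => /(_ rho0).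
  by rewrite /M -[X in _ -> X - 1 <= _ < _]natr1 addrK.
have Mr : rho * M%:R <= 2.
  have : rho * (M%:R - 1) <= 1 by rewrite -[leRHS](mulfV (lt0r_neq0 rho0))
    ler_pM2l.
  rewrite mulrBr mulr1 => ?; lra.
have Mg : rho^-1 <= M%:R by exact: ltW.
pose A (f : {ffun 'I_n -> 'I_M}) := small_proj (grid_point R f) (2 * n.+1)%:R.
have mA f : measurable (A f) by exact: measurable_small_proj.
have gA f : (gamma (small_proj x r) <= gamma (A f))%E.
  have [z0|z0] := eqVneq (grid_point R f) 0.
    rewrite (_ : A f = setT) ?probability_setT ?probability_le1//;
      first exact: measurable_small_proj.
    apply/seteqP; split => // V _; rewrite /A /small_proj /= z0.
    by rewrite (le_trans (enorm_orthproj_le _ _))// enorm0.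
  rewrite (small_proj_scale _ x0 z0); apply: le_measure; rewrite ?inE;
    [exact: measurable_small_proj|exact: mA|].
  move=> V; rewrite /A /small_proj /= => /le_trans; apply.
  rewrite mulrA mulrAC -/rho (le_trans (ler_wpM2l (ltW rho0) (enorm_grid_point
    R f)))//.
  by rewrite natrM mulrCA mulrC natrM ler_pM2r.
(* The sum is the integral over V of the number of grid points with small projection to V, which
   [grid_count] bounds for every V. *)
have sumA : (\sum_(f : {ffun 'I_n -> 'I_M}) gamma (A f) <= (C * M ^ (n -
  m))%:R%:E)%E.
  under eq_bigr => f _ do rewrite -(setIT (A f)) -integral_indic//.
  rewrite -ge0_integral_sum//; last first.
    by move=> f; apply/measurable_EFinP; exact: measurable_indic.
  apply: (@le_trans _ _ (\int[gamma]_V (cst (C * M ^ (n - m))%:R%:E V))%E);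
    last first.
    rewrite integral_cst// -[leRHS]mule1; apply: lee_wpmul2l;
      first by rewrite lee_fin.
    exact: probability_le1.
  apply: ge0_le_integral => //.
  - by move=> V _; apply: sume_ge0 => f _; rewrite lee_fin.
  - by apply: emeasurable_sum => f; apply/measurable_EFinP;
    exact: measurable_indic.
  - move=> V _; rewrite sumEFin lee_fin /=.
    have dV : \dim (sval V) = m by apply/eqP; exact: (svalP V).
    rewrite (le_trans _ (_ : #|[pred f : {ffun 'I_n ->
      'I_M} | (enorm (orthproj (sval V) (grid_point R f)) <= (2 *
      n.+1)%:R)%R]|%:R <= _))//; last first.
      by rewrite ler_nat; exact: HC.
    rewrite -sum1_card natr_sum [leRHS]big_mkcond /=; apply: ler_sum => f _.
    rewrite indicE; case: ifPn => Vf; first by case: (_ \in _).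
    by rewrite memNset// => VA; move/negP: Vf; apply.
have gE : gamma (small_proj x r) = (fine (gamma (small_proj x r)))%:E.
  by rewrite fineK// fin_num_measure//; exact: measurable_small_proj.
move: gA; rewrite gE; set g := fine _ => gA.
have g0 : 0 <= g by exact: fine_ge0.
have {sumA} : (\sum_(f : {ffun 'I_n -> 'I_M}) g%:E <= (C * M ^ (n -
  m))%:R%:E)%E.
  by apply: le_trans sumA; apply: lee_sum => f _; exact: gA.
rewrite sumEFin !lee_fin sumr_const card_ffun !card_ord -[leLHS]mulr_natr.
rewrite -{1}(subnK le_mn) expnD natrM [leRHS]natrM mulrCA mulrC [leRHS]mulrC
  mulrC.
rewrite ler_pM2l ?ltr0n ?expn_gt0// => gM.
rewrite (@le_trans _ _ (C%:R * rho ^+ m))//; last first.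
  by rewrite ler_wpM2r ?exprn_ge0 ?(ltW rho0)// lerDl.
rewrite -[rho]invrK exprVn ler_pdivlMr ?exprn_gt0 ?invr_gt0// (le_trans _ gM)//.
by rewrite ler_wpM2l// natrX lerXn2r ?nnegrE ?invr_ge0 ?(ltW rho0).
Qed.

End GrassmannMeasure.

(** * The threshold kernel *)

Section Kernels.
Variable R : realType.
Implicit Types (r d t s theta a b : R).

(* [min{1, (r / d)^m}], written without a case distinction at [d = 0]. *)
Definition riesz (m : nat) r d : R := (r / Num.max r d) ^+ m.

Lemma riesz_ge0 m r d : 0 <= r -> 0 <= riesz m r d.
Proof. by move=> r0; rewrite exprn_ge0// divr_ge0// le_max r0. Qed.

Lemma riesz_le1 m r d : 0 < r -> riesz m r d <= 1.
Proof.
move=> r0; rewrite exprn_ile1//; first by rewrite divr_ge0 ?le_max ?(ltW r0).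
by rewrite ler_pdivrMr ?lt_max ?r0// mul1r le_max lexx.
Qed.

Lemma riesz0 m r : 0 < r -> riesz m r 0 = 1.
Proof. by move=> r0; rewrite /riesz max_l ?(ltW r0)// divff ?gt_eqF//
  expr1n. Qed.

(** In the variables a = log r and b = log d every branch of the kernels is the exponential of an
    affine expression in a and b, so comparing kernels becomes comparing such expressions case by
    case. *)
Lemma riesz_expR m a b :
  riesz m (expR a) (expR b) = if b <= a then 1 else expR (m%:R * (a - b)).
Proof.
rewrite /riesz; case: ifPn => [ba|].
  by rewrite max_l ?ler_expR// divff ?gt_eqF ?expR_gt0// expr1n.
rewrite -ltNge => ab.
by rewrite max_r ?ler_expR ?(ltW ab)// -expRN -expRD expRM_natl.
Qed.

Lemma le_riesz m r r' d : 0 < r -> r <= r' -> 0 <= d ->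
  riesz m r d <= riesz m r' d.
Proof.
move=> r0 rr d0; have r'0 : 0 < r' by exact: lt_le_trans rr.
rewrite /riesz lerXn2r// ?nnegrE ?divr_ge0 ?le_max ?(ltW r0) ?(ltW r'0)//.
have M0 : 0 < Num.max r d by rewrite lt_max r0.
have M'0 : 0 < Num.max r' d by rewrite lt_max r'0.
rewrite ler_pdivrMr// mulrAC ler_pdivlMr//.
case: (leP r' d) => [r'd|dr'].
  by rewrite max_r ?(le_trans rr)// ler_pM2r// (lt_le_trans _ r'd).
by rewrite mulrC ler_pM2l// le_max lexx.
Qed.

Lemma powR_expR a t : expR a `^ t = expR (a * t).
Proof. by rewrite expRM. Qed.

Lemma expR_surj r : 0 < r -> exists a, r = expR a.
Proof. by move=> r0; exists (ln r); rewrite lnK// posrE. Qed.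

Lemma threshold_kernel_ge0 t s theta r d : 0 <= threshold_kernel t s theta r d.
Proof.
rewrite /threshold_kernel; case: ifP => // _.
by rewrite !le_min ler01 !mulr_ge0 ?powR_ge0.
Qed.

Lemma threshold_kernel_expR t s theta a b :
  threshold_kernel t s theta (expR a) (expR b) =
  Num.min 1 (Num.min (expR (t * (a - b))) (expR ((theta * (s - t) + t) * a - s
    * b))).
Proof.
rewrite /threshold_kernel gt_eqF ?expR_gt0// !powR_expR -!expRD.
by congr (Num.min _ (Num.min (expR _) (expR _))); ring.
Qed.

Lemma expR_ge1 a : (1 <= expR a) = (0 <= a).
Proof. by rewrite -{1}(@expR0 R) ler_expR. Qed.

Lemma lt_expR1 a : expR a < 1 -> a < 0.
Proof. by rewrite expR_lt1. Qed.

(** The second and third branches of the threshold kernel meet at d = r^theta. The quotient of the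
    two kernels is largest there, and the exponent theta (m - t) - m is the one giving equality at
    that point. *)
Lemma threshold_kernel_le_riesz (m n : nat) t theta r d :
  0 < r < 1 -> 0 <= d -> 0 <= theta <= 1 -> 0 <= t <= m%:R -> (m <= n)%N ->
  r `^ (- t) * threshold_kernel t n%:R theta r d <=
  r `^ (theta * (m%:R - t) - m%:R) * riesz m r d.
Proof.
move=> /andP[r0 r1] d0 /andP[th0 th1] /andP[t0 tm]; rewrite -(ler_nat R) => mn.
have [a ra] := expR_surj r0; move: r1; rewrite ra => /lt_expR1 a0.
have h : 0 <= (m%:R - t) * (1 - theta) * - a.
  by rewrite !mulr_ge0 ?subr_ge0// oppr_ge0 ltW.
move: d0; rewrite le_eqVlt => /predU1P[<-|/expR_surj[b ->]].
  rewrite riesz0 ?expR_gt0// /threshold_kernel eqxx !mulr1 !powR_expR ler_expR.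
  by lra.
rewrite riesz_expR threshold_kernel_expR !powR_expR.
case: ifPn => [ba|]; last rewrite -ltNge => ab.
  apply: (@le_trans _ _ (expR (a * - t) * 1)).
    by rewrite ler_pM2l ?expR_gt0// ge_min lexx.
  by rewrite !mulr1 ler_expR; lra.
rewrite -expRD; have [bth|thb] := leP b (theta * a).
  apply: (@le_trans _ _ (expR (a * - t) * expR (t * (a - b)))).
    by rewrite ler_pM2l ?expR_gt0// !ge_min lexx orbT.
  rewrite -expRD ler_expR.
  have : 0 <= (m%:R - t) * (theta * a - b) by rewrite mulr_ge0 ?subr_ge0.
  by lra.
apply: (@le_trans _ _ (expR (a * - t) * expR ((theta * (n%:R - t) + t) * a -
  n%:R * b))).
  by rewrite ler_pM2l ?expR_gt0// !ge_min lexx !orbT.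
rewrite -expRD ler_expR.
have : 0 <= (n%:R - m%:R) * (b - theta * a) by rewrite mulr_ge0 ?subr_ge0// ltW.
by lra.
Qed.

(** Up to d = r^theta the threshold kernel is min(1, (r / d)^t), which dominates because t <= m;
    beyond, the Riesz kernel is itself at most r^(m (1 - theta)). *)
Lemma riesz_le_threshold_kernel (m n : nat) t theta r d :
  0 < r < 1 -> 0 <= d -> 0 <= theta <= 1 -> 0 <= t <= m%:R -> (m <= n)%N ->
  riesz m r d <= threshold_kernel t n%:R theta r d + r `^ (m%:R * (1 - theta)).
Proof.
move=> /andP[r0 r1] d0 /andP[th0 th1] /andP[t0 tm]; rewrite -(ler_nat R) => mn.
have m0 : (0 : R) <= m%:R by [].
have [a ra] := expR_surj r0; move: r1; rewrite ra => /lt_expR1 a0.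
move: d0; rewrite le_eqVlt => /predU1P[<-|/expR_surj[b ->]].
  by rewrite riesz0 ?expR_gt0// /threshold_kernel eqxx lerDl powR_ge0.
rewrite riesz_expR threshold_kernel_expR powR_expR.
have [bth|thb] := leP b (theta * a); last first.
  have ath : a <= theta * a.
    have : 0 <= (1 - theta) * - a by rewrite mulr_ge0 ?subr_ge0// oppr_ge0 ltW.
    by lra.
  rewrite ifF; last by apply/negbTE; rewrite -ltNge (le_lt_trans ath).
  apply: (@le_trans _ _ (expR (a * (m%:R * (1 - theta))))).
    rewrite ler_expR; have : 0 <= m%:R * (b - theta * a) by rewrite mulr_ge0
      ?subr_ge0// ltW.
    by lra.
  by rewrite lerDr !le_min ler01 !expR_ge0.
apply: (@le_trans _ _ (Num.min 1 (Num.min (expR (t * (a - b))) (expR ((theta *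
  (n%:R - t) + t) * a - n%:R * b)))));
  last by rewrite lerDl expR_ge0.
have h : t * (a - b) <= (theta * (n%:R - t) + t) * a - n%:R * b.
  have : 0 <= (n%:R - t) * (theta * a - b) by rewrite mulr_ge0 ?subr_ge0
    ?(le_trans tm).
  by lra.
rewrite !le_min; case: ifPn => [ba|]; last rewrite -ltNge => ab.
  have h0 : 0 <= t * (a - b) by rewrite mulr_ge0 ?subr_ge0.
  by rewrite lexx !expR_ge1 h0 (le_trans h0 h).
have h1 : m%:R * (a - b) <= t * (a - b).
  have : 0 <= (m%:R - t) * (b - a) by rewrite mulr_ge0 ?subr_ge0// ltW.
  by lra.
by rewrite !ler_expR expR_le1 h1 (le_trans h1 h) !andbT mulr_ge0_le0//
  subr_le0 ltW.
Qed.

Lemma threshold_kernel_mono_t (n : nat) t t2 theta r d :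
  0 < r < 1 -> 0 <= d -> 0 <= theta <= 1 -> 0 <= t <= t2 -> t2 <= n%:R ->
  r `^ (- t) * threshold_kernel t n%:R theta r d <=
  r `^ (- t2) * threshold_kernel t2 n%:R theta r d.
Proof.
move=> /andP[r0 r1] d0 /andP[th0 th1] /andP[t0 tt2] t2n.
have [a ra] := expR_surj r0; move: r1; rewrite ra => /lt_expR1 a0.
have h : 0 <= (t2 - t) * - a by rewrite mulr_ge0 ?subr_ge0// oppr_ge0 ltW.
have hth : 0 <= theta * ((t2 - t) * - a) by rewrite mulr_ge0.
move: d0; rewrite le_eqVlt => /predU1P[<-|/expR_surj[b ->]].
  by rewrite /threshold_kernel eqxx !mulr1 !powR_expR ler_expR; lra.
rewrite !threshold_kernel_expR !powR_expR.
rewrite -[leRHS](@mulrC R) -ler_pdivrMr ?expR_gt0// -expRN mulrAC -expRD.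
set c := a * - t + _.
have X1 : expR c * Num.min 1 (Num.min (expR (t * (a - b))) (expR ((theta *
  (n%:R - t) + t) * a - n%:R * b))) <= expR c.
  by rewrite ler_piMr ?expR_ge0// ge_min lexx.
have X2 : expR c * Num.min 1 (Num.min (expR (t * (a - b))) (expR ((theta *
  (n%:R - t) + t) * a - n%:R * b))) <= expR (c + t * (a - b)).
  by rewrite [leRHS]expRD ler_pM2l ?expR_gt0// !ge_min lexx !orbT.
have X3 : expR c * Num.min 1 (Num.min (expR (t * (a - b))) (expR ((theta *
  (n%:R - t) + t) * a - n%:R * b))) <= expR (c + ((theta * (n%:R - t) + t) * a
  - n%:R * b)).
  by rewrite [leRHS]expRD ler_pM2l ?expR_gt0// !ge_min lexx !orbT.
have c0 : c <= 0 by rewrite /c; lra.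
have h3 : c + ((theta * (n%:R - t) + t) * a - n%:R * b) <= (theta * (n%:R - t2)
  + t2) * a - n%:R * b.
  by rewrite /c; lra.
rewrite !le_min; apply/and3P; split.
- by rewrite (le_trans X1)// expR_le1.
(* Here b = 0 means d = 1. For d <= 1 the second branches compare directly; for d > 1, which lies
   beyond r^theta, the third branch at [t2] is below the second one. *)
- have [b0|b0] := leP b 0.
    rewrite (le_trans X2)// ler_expR /c.
    have : 0 <= (t2 - t) * - b by rewrite mulr_ge0 ?subr_ge0// oppr_ge0.
    by lra.
  rewrite (le_trans X3)// ler_expR (le_trans h3)//.
  have : 0 <= (n%:R - t2) * (b - theta * a).
    rewrite mulr_ge0 ?subr_ge0// (le_trans _ (ltW b0))// mulr_ge0_le0// ltW//.
  by lra.
- by rewrite (le_trans X3)// ler_expR.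
Qed.

Lemma threshold_kernel_mono_theta t s theta theta' r d :
  0 < r < 1 -> 0 <= d -> t <= s -> theta <= theta' ->
  threshold_kernel t s theta' r d <= threshold_kernel t s theta r d.
Proof.
move=> /andP[r0 r1] d0 ts tt.
have [a ra] := expR_surj r0; move: r1; rewrite ra => /lt_expR1 a0.
move: d0; rewrite le_eqVlt => /predU1P[<-|/expR_surj[b ->]].
  by rewrite /threshold_kernel eqxx.
rewrite !threshold_kernel_expR !le_min !ge_min !lexx ?orbT /=.
apply/orP; right; apply/orP; right; rewrite ler_expR.
have : 0 <= (theta' - theta) * (s - t) * - a.
  by rewrite !mulr_ge0 ?subr_ge0// oppr_ge0 ltW.
by lra.
Qed.

End Kernels.

(** Puts a zero lower limit in a form where kernel comparisons can be applied at one chosen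
    radius. *)
Lemma limf_einf_right0P (R : realType) (f : R -> \bar R) :
  (forall r, (0 <= f r)%E) ->
  limf_einf f 0^'+ = 0%E <->
  (forall e d : R, 0 < e -> 0 < d -> exists2 r, 0 < r < d & (f r < e%:E)%E).
Proof.
move=> f0; rewrite limf_einfE; split=> [fE e d e0 d0|H].
  have : (ereal_inf (f @` [set r : R | (0 < r < d)%R]) <= 0)%E.
    rewrite -fE; apply: ereal_sup_ubound; exists [set r | 0 < r < d] => //.
    near=> r; rewrite /=; apply/andP; split; near: r.
      exact: nbhs_right_gt.
    exact: nbhs_right_lt.
  move=> /le_lt_trans/(_ (_ : (0 < e%:E)%E)); rewrite lte_fin => /(_ e0).
  by move=> /ereal_inf_lt[_ [r rd <-] re]; exists r.
apply/eqP; rewrite eq_le; apply/andP; split.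
  apply: ge_ereal_sup => _ [V V0 <-].
  apply/lee_addgt0Pr => e e0; rewrite add0e.
  move: V0; rewrite /at_right /within => /nbhs_ballP[d /= d0 dV].
  have [r /andP[r0 rd] re] := H e d e0 d0.
  apply: (le_trans _ (ltW re)); apply: ereal_inf_lbound; exists r => //.
  by apply: dV => //; rewrite /ball /= sub0r normrN gtr0_norm.
apply: (@le_trans _ _ (ereal_inf (f @` setT))).
  by apply: le_ereal_inf_tmp => _ [r _ <-].
by apply: ereal_sup_ubound; exists setT => //; exact: filterT.
Unshelve. all: by end_near. Qed.

(** * The potential F_m and its relation to the threshold potentials *)

Section Profile.
Variables (R : realType) (n : nat) (mu : probability (borel 'rV[R]_n) R).
Implicit Types (x : 'rV[R]_n) (r t theta : R).

(** This is the potential F_m(x, r) of the overview. *)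
Definition profile m x r : \bar R :=
  (\int[mu]_y (riesz m r (enorm (x - (y : 'rV[R]_n))))%:E)%E.

(* Dyadic form of [liminf_(r -> 0) r^-t profile m x r = 0]. *)
Definition thin_profile m t x : Prop :=
  forall (e : R) J, 0 < e -> exists2 j, (J <= j)%N &
    (profile m x (dyad R j) < (e * dyad R j `^ t)%:E)%E.

Lemma measurable_enorm_sub x :
  measurable_fun setT (fun y : borel 'rV[R]_n => enorm (x - (y : 'rV[R]_n))).
Proof.
apply: (@measurable_enorm _ _ _ (borel 'rV[R]_n) (fun y => x - y)) => i.
rewrite (_ : (fun _ => _) = (fun y : borel 'rV[R]_n =>
  x ord0 i - (y : 'rV[R]_n) ord0 i)).
  by apply: measurable_funB => //; exact: measurable_coord.
by apply/funext => y; rewrite !mxE.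
Qed.

Lemma measurable_riesz m r : 0 < r -> measurable_fun setT (riesz m r).
Proof.
move=> r0; rewrite (_ : riesz m r = (fun d => (r * (Num.max r d) `^ (-1)) ^+
  m)).
  apply: measurable_funX; apply: measurable_funM => //.
  apply: (measurableT_comp (measurable_powR (-1))).
  exact: measurable_maxr.
by apply/funext => d; rewrite powR_inv1// le_max (ltW r0).
Qed.

Lemma measurable_threshold_kernel t s theta r :
  measurable_fun setT (threshold_kernel t s theta r).
Proof.
apply: measurable_fun_ifT => //; first exact: measurable_fun_eqr.
apply: measurable_minr => //; apply: measurable_minr;
  by apply: measurable_funM => //; exact: measurable_powR.
Qed.

Let mtk t s theta r x : measurable_fun setT (fun y : borel 'rV[R]_n =>
  (threshold_kernel t s theta r (enorm (x - (y : 'rV[R]_n))))%:E).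
Proof.
apply/measurable_EFinP.
exact: (measurableT_comp (measurable_threshold_kernel _ _ _ _)
  (measurable_enorm_sub x)).
Qed.

Let mrz m r x : 0 < r -> measurable_fun setT (fun y : borel 'rV[R]_n =>
  (riesz m r (enorm (x - (y : 'rV[R]_n))))%:E).
Proof.
move=> r0; apply/measurable_EFinP.
exact: (measurableT_comp (measurable_riesz _ r0) (measurable_enorm_sub x)).
Qed.

Lemma threshold_potential_ge0 t s theta x r : (0 <= threshold_potential mu t s
  theta x r)%E.
Proof. by apply: integral_ge0 => y _; rewrite lee_fin threshold_kernel_ge0. Qed.

Lemma le_profile m x r r' : 0 < r -> r <= r' -> (profile m x r <= profile m x
  r')%E.
Proof.
move=> r0 rr; have r'0 : 0 < r' by exact: lt_le_trans rr.
apply: ge0_le_integral => //.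
- by move=> y _; rewrite lee_fin riesz_ge0// ltW.
- exact: mrz.
- exact: mrz.
- by move=> y _; rewrite lee_fin le_riesz// enorm_ge0.
Qed.

Lemma threshold_potential_le_profile m t theta x r :
  0 < r < 1 -> 0 <= theta <= 1 -> 0 <= t <= m%:R -> (m <= n)%N ->
  ((r `^ (- t))%:E * threshold_potential mu t n%:R theta x r <=
   (r `^ (theta * (m%:R - t) - m%:R))%:E * profile m x r)%E.
Proof.
move=> r01 th tm mn; have /andP[r0 _] := r01.
rewrite -!ge0_integralZl//; last 5 first.
- exact: mrz.
- by move=> y _; rewrite lee_fin riesz_ge0// ltW.
- by rewrite lee_fin powR_ge0.
- by move=> y _; rewrite lee_fin threshold_kernel_ge0.
- by rewrite lee_fin powR_ge0.
apply: ge0_le_integral => //.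
- by move=> y _; rewrite -EFinM lee_fin mulr_ge0 ?powR_ge0//
  threshold_kernel_ge0.
- exact: measurable_funeM.
- by apply: measurable_funeM; exact: mrz.
- by move=> y _; rewrite -!EFinM lee_fin threshold_kernel_le_riesz// enorm_ge0.
Qed.

Lemma profile_le_threshold_potential m t theta x r :
  0 < r < 1 -> 0 <= theta <= 1 -> 0 <= t <= m%:R -> (m <= n)%N ->
  (profile m x r <=
   threshold_potential mu t n%:R theta x r + (r `^ (m%:R * (1 - theta)))%:E)%E.
Proof.
move=> r01 th tm mn; have /andP[r0 _] := r01.
set c := (r `^ _)%:E.
have c0 : (0 <= c)%E by rewrite lee_fin powR_ge0.
have -> : c = (\int[mu]_y (cst c y))%E.
  rewrite integral_cst// -[LHS]mule1; congr (_ * _)%E.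
  exact/esym/probability_setT.
rewrite -ge0_integralD//; last by move=> y _; rewrite lee_fin
  threshold_kernel_ge0.
apply: ge0_le_integral => //.
- by move=> y _; rewrite lee_fin riesz_ge0// ltW.
- exact: mrz.
- exact: emeasurable_funD.
- by move=> y _; rewrite /= -EFinD lee_fin riesz_le_threshold_kernel//
  enorm_ge0.
Qed.

Lemma threshold_potential_mono_t t t2 theta x r :
  0 < r < 1 -> 0 <= theta <= 1 -> 0 <= t <= t2 -> t2 <= n%:R ->
  ((r `^ (- t))%:E * threshold_potential mu t n%:R theta x r <=
   (r `^ (- t2))%:E * threshold_potential mu t2 n%:R theta x r)%E.
Proof.
move=> r01 th tt t2n; have /andP[r0 _] := r01.
rewrite -!ge0_integralZl//; last 4 first.
- by move=> y _; rewrite lee_fin threshold_kernel_ge0.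
- by rewrite lee_fin powR_ge0.
- by move=> y _; rewrite lee_fin threshold_kernel_ge0.
- by rewrite lee_fin powR_ge0.
apply: ge0_le_integral => //.
- by move=> y _; rewrite -EFinM lee_fin mulr_ge0 ?powR_ge0//
  threshold_kernel_ge0.
- exact: measurable_funeM.
- exact: measurable_funeM.
- by move=> y _; rewrite -!EFinM lee_fin threshold_kernel_mono_t// enorm_ge0.
Qed.

Lemma threshold_potential_mono_theta t theta theta' x r :
  0 < r < 1 -> t <= n%:R -> theta <= theta' ->
  (threshold_potential mu t n%:R theta' x r <= threshold_potential mu t n%:R
    theta x r)%E.
Proof.
move=> r01 tn tt; apply: ge0_le_integral => //.
- by move=> y _; rewrite lee_fin threshold_kernel_ge0.
- by move=> y _; rewrite lee_fin threshold_kernel_mono_theta// enorm_ge0.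
Qed.

(** Repeats verbatim the pointwise condition inside [packing_dim_theta], so that the two agree by
    computation. *)
Definition vanishing theta t x : Prop :=
  limf_einf (fun r : R => (r `^ (- t))%:E * threshold_potential mu t n%:R theta
    x r)%E
    0^'+ = 0%E.

Lemma vanishingP theta t x : vanishing theta t x <->
  (forall e d : R, 0 < e -> 0 < d -> exists2 r, 0 < r < d &
    ((r `^ (- t))%:E * threshold_potential mu t n%:R theta x r < e%:E)%E).
Proof.
apply: limf_einf_right0P => r.
by rewrite mule_ge0 ?threshold_potential_ge0// lee_fin powR_ge0.
Qed.

Lemma vanishing_le theta theta' t t' x : 0 <= theta <= 1 -> theta <= theta' ->
  0 <= t' <= t -> t <= n%:R -> vanishing theta t x -> vanishing theta' t' x.
Proof.
move=> th tt t't tn /vanishingP H; apply/vanishingP => e d e0 d0.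
(* Both monotonicity statements for the potential require r < 1. *)
have [|r /andP[r0 rd] re] := H e (Num.min d 1) e0;
  first by rewrite lt_min d0 ltr01.
move: rd; rewrite lt_min => /andP[rd r1].
exists r; first by rewrite r0.
apply: le_lt_trans re.
apply: le_trans (threshold_potential_mono_t _ _ th t't tn); last by rewrite r0.
apply: lee_wpmul2l; first by rewrite lee_fin powR_ge0.
apply: threshold_potential_mono_theta => //; first by rewrite r0.
by have /andP[_ h] := t't; exact: le_trans tn.
Qed.

Lemma thin_profile_le m t t' x : t' <= t -> thin_profile m t x ->
  thin_profile m t' x.
Proof.
move=> tt H e J e0; have [j Jj jt] := H e J e0; exists j => //.
apply: (lt_le_trans jt); rewrite lee_fin ler_pM2l//.
by apply: ger_powR => //; rewrite dyad_gt0 dyad_le1.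
Qed.

(** The exponent m - theta (m - t) exactly cancels the prefactor in
    [threshold_potential_le_profile]. *)
Lemma thin_profile_vanishing m theta t x : 0 < theta <= 1 -> 0 <= t ->
  t < m%:R ->
  (m <= n)%N ->
  thin_profile m (m%:R - theta * (m%:R - t)) x -> vanishing theta t x.
Proof.
move=> /andP[th0 th1] t0 tm mn H; apply/vanishingP => e d e0 d0.
have d20 : 0 < d / 2 by rewrite divr_gt0.
have [J HJ] := dyad_small d20.
have [j] := H e (maxn J 1) e0; rewrite geq_max => /andP[Jj j0] je.
have r01 : 0 < dyad R j < 1.
  by rewrite dyad_gt0 (le_lt_trans (le_dyad _ j0))// /dyad expr1 invf_lt1//
    ltr1n.
exists (dyad R j).
  by rewrite dyad_gt0 (le_lt_trans (HJ j Jj))// ltr_pdivrMr// ltr_pMr// ltr1n.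
have := @threshold_potential_le_profile m t theta x _ r01.
rewrite (ltW th0) th1 t0 (ltW tm) => /(_ isT isT mn)/le_lt_trans; apply.
rewrite -lte_pdivlMl ?powR_gt0 ?dyad_gt0//.
by rewrite -EFinM -powRN opprB mulrC.
Qed.

Lemma vanishing_thin_profile m theta t t' x : 0 < theta <= 1 -> 0 <= t' ->
  t' < t -> t <= m%:R -> t' < m%:R * (1 - theta) -> (m <= n)%N ->
  vanishing theta t x -> thin_profile m t' x.
Proof.
move=> /andP[th0 th1] t'0 t't tm mth mn /vanishingP H e J e0.
(* The half shares e between the potential and the error term; 2^t' pays for replacing r by the
   dyadic radius 2^-j > r / 2. *)
pose c : R := e / 2 / 2 `^ t'.
have c0 : 0 < c by rewrite !divr_gt0 ?powR_gt0.
have small (u : R) : 0 < u -> exists2 d : R, 0 < d & forall r, 0 < r <= d ->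
  r `^ u <= c.
  move=> u0; exists (c `^ u^-1); first by rewrite powR_gt0.
  move=> r /andP[r0 rd]; rewrite -[leRHS]powRr1 ?(ltW c0)//
    -(mulVf (lt0r_neq0 u0)) powRrM.
  by apply: ge0_ler_powR; rewrite ?nnegrE ?(ltW u0) ?(ltW r0) ?powR_ge0.
have [d2 d20 Hd2] := small (m%:R * (1 - theta) - t') (ltac:(by rewrite
  subr_gt0)).
pose d := Num.min (dyad R J.+1) d2.
have d0 : 0 < d by rewrite lt_min dyad_gt0.
have [r /andP[r0 rd] re] := H c d c0 d0.
move: rd; rewrite lt_min => /andP[rJ rd2].
have rJ' : 0 < r <= dyad R J.+1 by rewrite r0 ltW.
have [j Jj /andP[jr rj]] := dyad_bracket rJ'.
have r1 : r < 1 by rewrite (lt_le_trans rJ)// dyad_le1.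
exists j; first exact: ltnW.
apply: (le_lt_trans (le_profile _ _ (dyad_gt0 R j) jr)).
have t0 : 0 <= t by rewrite (le_trans t'0)// ltW.
apply: (@le_lt_trans _ _ (threshold_potential mu t n%:R theta x r + (r `^ (m%:R
  * (1 - theta)))%:E)%E).
  by apply: profile_le_threshold_potential; rewrite ?r0 ?th1 ?t0 ?(ltW th0).
have pe : (threshold_potential mu t n%:R theta x r < (c * r `^ t)%:E)%E.
  by move: re; rewrite -lte_pdivlMl ?powR_gt0// -powRN opprK -EFinM mulrC.
apply: (@lt_le_trans _ _ (c * r `^ t + c * r `^ t')%:E).
  rewrite EFinD; apply: lte_leD => //; rewrite lee_fin.
  rewrite -[m%:R * _](subrK t') powRD; last by apply/implyP => _;
    rewrite gt_eqF.
  by rewrite ler_pM2r ?powR_gt0// Hd2// r0 ltW.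
rewrite lee_fin (@le_trans _ _ (c * r `^ t' + c * r `^ t'))//.
  by rewrite lerD2r ler_pM2l//; apply: ger_powR; rewrite ?r0 ?ltW.
rewrite -mulr2n -mulr_natl mulrA /c.
rewrite (@le_trans _ _ (2 * (e / 2 / 2 `^ t') * (2 * dyad R j) `^ t'))//.
  rewrite ler_pM2l ?mulr_gt0//; apply: ge0_ler_powR => //;
    rewrite ?nnegrE ?mulr_ge0 ?(ltW r0) ?(ltW (dyad_gt0 _ _))//.
  exact: ltW.
rewrite powRM ?(ltW (dyad_gt0 _ _))// le_eqVlt; apply/orP; left; apply/eqP.
by field; rewrite gt_eqF// powR_gt0.
Qed.

End Profile.

(** * The threshold parameter in terms of F_m *)

Section ThresholdCharacterization.
Variables (R : realType) (n : nat) (mu : probability (borel 'rV[R]_n) R).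
Implicit Types (t theta : R).

Let S theta : set R := [set t | 0 <= t <= n%:R /\
  {ae mu, forall x : 'rV[R]_n, vanishing mu theta t x}].

Let D theta := packing_dim_theta mu theta.

Let DE theta : D theta = sup (S theta).
Proof. by []. Qed.

Let S_ub theta : ubound (S theta) n%:R.
Proof. by move=> t [/andP[]]. Qed.

Let D_ge0 theta : 0 <= D theta.
Proof.
have [S0|/set0P[t [/andP[t0 tn] tS]]] := eqVneq (S theta) set0.
  by rewrite DE S0 sup0.
rewrite DE; apply: (le_trans t0); apply: ub_le_sup; first by exists n%:R;
  exact: S_ub.
by split; first rewrite t0.
Qed.

Let D_mono theta theta' : 0 <= theta <= 1 -> theta <= theta' ->
  D theta <= D theta'.
Proof.
move=> th tt; have [S0|/set0P S0] := eqVneq (S theta) set0.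
  by rewrite (DE theta) S0 sup0.
rewrite !DE; apply: ge_sup => // t [t0n tS]; apply: ub_le_sup;
  first by exists n%:R; exact: S_ub.
split; first exact: t0n.
apply: (@filterS _ _ (ae_filter_ringOfSetsType mu)) tS => x;
  have /andP[t0 tn] := t0n.
by apply: vanishing_le => //; rewrite t0 lexx.
Qed.

Let cvD : cvg (D theta @[theta --> 0^'+]).
Proof.
apply: nondecreasing_at_right_is_cvgr.
  near=> a => u v; rewrite !in_itv /= => /andP[u0 ua] /andP[v0 va] uv.
  apply: D_mono => //; rewrite (ltW u0)/= (le_trans (ltW ua))//.
  by near: a; exact: nbhs_right_ltW.
by near=> a; exists 0 => _ [u _ <-]; exact: D_ge0.
Unshelve. all: by end_near. Qed.

Lemma threshold_geP m : (0 < m)%N -> (m <= n)%N ->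
  m%:R <= threshold mu <->
  (forall t, t < m%:R -> {ae mu, forall x : 'rV[R]_n, thin_profile mu m t x}).
Proof.
move=> m0 mn; have m0' : (0 : R) < m%:R by rewrite ltr0n.
split => [mD t tm|H].
  pose t' := Num.max t 0.
  have t'm : t' < m%:R by rewrite gt_max tm.
  have t'0 : 0 <= t' by rewrite le_max lexx orbT.
  (* Then m (1 - theta) = (m + t') / 2 exceeds t', so the error term of the kernel comparison is
     negligible at exponent t'. *)
  pose theta : R := (m%:R - t') / (2 * m%:R).
  have th0 : 0 < theta by rewrite divr_gt0 ?subr_gt0// mulr_gt0.
  have th1 : theta <= 1 by rewrite ler_pdivrMr ?mulr_gt0//; lra.
  have thm : m%:R * (1 - theta) = (m%:R + t') / 2.
    by rewrite /theta; field; rewrite gt_eqF.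
  have mDt : m%:R <= D theta.
    apply: (le_trans mD); apply: limr_le; first exact: cvD.
    near=> a; apply: D_mono; last by near: a; exact: nbhs_right_ltW.
    rewrite (_ : 0 <= a)/=; last by near: a; exact: nbhs_right_ge.
    by near: a; exact: nbhs_right_ltW.
  pose t1 := (m%:R + t') / 2.
  have t1m : t1 < m%:R by rewrite /t1; lra.
  have t't1 : t' < t1 by rewrite /t1; lra.
  have [t2 [/andP[t20 t2n] t2S] t12] : exists2 t2, S theta t2 & t1 < t2.
    rewrite DE in mDt; apply: sup_gt; last exact: lt_le_trans mDt.
    apply/set0P/negP => /eqP S0; move: mDt; rewrite S0 sup0.
    by rewrite leNgt m0'.
  have th01 : 0 < theta <= 1 by rewrite th0.
  have th01' : 0 <= theta <= 1 by rewrite (ltW th0).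
  have t12' : 0 <= t1 <= t2 by rewrite (le_trans t'0 (ltW t't1)) ltW.
  have t'th : t' < m%:R * (1 - theta) by rewrite thm.
  have tt' : t <= t' by rewrite le_max lexx.
  apply: (@filterS _ _ (ae_filter_ringOfSetsType mu)) t2S => x vx.
  apply: (thin_profile_le tt').
  apply: (vanishing_thin_profile th01 t'0 t't1 (ltW t1m) t'th mn).
  exact: (vanishing_le th01' (lexx theta) t12' t2n vx).
apply: limr_ge; first exact: cvD.
near=> theta.
have th01 : 0 < theta <= 1.
  apply/andP; split; near: theta; [exact: nbhs_right_gt|exact: nbhs_right_ltW].
rewrite -/(D theta) leNgt; apply/negP => Dm.
(* Because m - theta (m - t) < m, the hypothesis puts this t in [S theta], above its supremum. *)
pose t := (D theta + m%:R) / 2.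
have Dt : D theta < t by rewrite /t; lra.
have tm : t < m%:R by rewrite /t; lra.
have t0 : 0 <= t by rewrite (le_trans (D_ge0 theta))// ltW.
have tS : S theta t.
  split; first by rewrite t0 (le_trans (ltW tm))// ler_nat.
  have /andP[th0 th1] := th01.
  have h : m%:R - theta * (m%:R - t) < m%:R.
    by rewrite gtrBl mulr_gt0// subr_gt0.
  by apply: (@filterS _ _ (ae_filter_ringOfSetsType mu)) (H _ h) => x;
    apply: thin_profile_vanishing.
have := ub_le_sup (ex_intro _ n%:R (@S_ub theta)) tS.
by rewrite -DE leNgt Dt.
Unshelve. all: by end_near. Qed.

End ThresholdCharacterization.

(** * Projections of the measure *)

Section Pushforward.
Context d1 d2 (T1 : measurableType d1) (T2 : measurableType d2) (R : realType).
Variables (mu : probability T1 R) (f : T1 -> T2).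
Hypothesis mf : measurable_fun setT f.

(** [measure_proj] is a bare set function, while thinness and doubling are stated for a
    [probability]. *)
Lemma pushforward_probability :
  exists P : probability T2 R, (P : set T2 -> \bar R) = pushforward mu f.
Proof using mf.
pose F : {mfun T1 >-> T2} := HB.pack f (isMeasurableFun.Build _ _ _ _ f mf).
by exists (distribution mu F).
Qed.

Lemma ae_pushforward (P : probability T2 R) (Q : T2 -> Prop) :
  (P : set T2 -> \bar R) = pushforward mu f ->
  {ae P, forall z, Q z} -> {ae mu, forall x, Q (f x)}.
Proof using mf.
move=> PE [N [mN N0 NQ]]; exists (f @^-1` N); split.
- by rewrite -[X in measurable X]setTI; exact: mf.
- by rewrite -N0 PE.
- by move=> x /= nQ; apply: NQ.
Qed.

End Pushforward.

Section LinearMaps.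
Variables (R : realType) (n k : nat) (M : 'M[R]_(n, k)).

Lemma continuous_mulmxr : continuous (fun x : 'rV[R]_n => x *m M).
Proof.
move=> x; have FF := @nbhs_filter 'rV[R]_n x.
apply/(@cvg_ballP _ _ _ _ FF) => e e0; near=> y; split => [//|i j];
  rewrite ord1 {i}.
suff : forall j, ball ((x *m M) ord0 j) e ((y *m M) ord0 j) by exact.
near: y; apply: filter_forall => {}j.
have : continuous (fun z : 'rV[R]_n => (z *m M) ord0 j).
  rewrite (_ : (fun _ => _) = (fun z : 'rV[R]_n => \sum_i z ord0 i * M i j)).
    elim: (index_enum _) => [|i r IH].
      rewrite (_ : (fun _ => _) = cst 0); first exact: cst_continuous.
      by apply/funext => z; rewrite big_nil.
    rewrite (_ : (fun _ => _) = (fun z : 'rV[R]_n => z ord0 i * M i j +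
      \sum_(i <- r) z ord0 i * M i j)); last by apply/funext => z;
        rewrite big_cons.
    have ci : continuous (fun z : 'rV[R]_n => z ord0 i * M i j).
      move=> z; apply: (@continuous_comp _ _ _ (fun y : 'rV[R]_n =>
        y ord0 i) (fun t => t * M i j)).
        exact: coord_continuous.
      exact: mulrr_continuous.
    by move=> z; exact: (@cvgD _ _ _ _ (nbhs_filter z) _ _ _ _ (ci z) (IH z)).
  by apply/funext => z; rewrite mxE.
by move=> /(_ x)/cvg_ballP; exact.
Unshelve. all: by end_near. Qed.

Lemma measurable_mulmxr :
  measurable_fun setT ((fun x => x *m M) : borel 'rV[R]_n -> borel 'rV[R]_k).
Proof.
apply: (@measurability _ _ (borel 'rV[R]_n) (borel 'rV[R]_k) setT _ (@open
  'rV[R]_k) erefl).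
move=> _ [U oU <-]; rewrite setTI; apply: sub_sigma_algebra.
by have /continuousP := continuous_mulmxr; exact.
Qed.

End LinearMaps.

(** For d <= 1 the least k with d <= 2^k 2^-j is at most j, and minimality gives d > 2^(k-1) 2^-j
    when k > 0, so the term of index k alone suffices. For d > 1 the last summand does. *)
Lemma riesz_le_dyadic_sum (R : realType) m j (d : R) : 0 <= d ->
  riesz m (dyad R j) d <=
  \sum_(k < j.+1) 2 ^+ m / (2 ^+ k) ^+ m * (d <= 2 ^+ k * dyad R j)%R%:R + dyad
    R j ^+ m.
Proof.
move=> d0; set S := \sum_(k < _) _.
have dy0 := dyad_gt0 R j.
have t0 (k : 'I_j.+1) : 0 <= 2 ^+ m / (2 ^+ k) ^+ m * (d <= 2 ^+ k * dyad R
  j)%R%:R :> R.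
  by rewrite mulr_ge0// divr_ge0 ?exprn_ge0.
have S0 : 0 <= S by apply: sumr_ge0 => k _; exact: t0.
have Sk (k : 'I_j.+1) : d <= 2 ^+ k * dyad R j -> 2 ^+ m / (2 ^+ k) ^+ m <= S.
  move=> dk; rewrite /S (bigD1 k)//= dk mulr1 lerDl sumr_ge0// => i _;
    exact: t0.
have [d1|d1] := ltP 1 d.
  rewrite (le_trans _ (_ : dyad R j ^+ m <= _))//; last by rewrite lerDr.
  have dd : dyad R j <= d by rewrite (le_trans (dyad_le1 _ _))// ltW.
  rewrite /riesz max_r// lerXn2r ?nnegrE ?divr_ge0// ?(ltW dy0)//.
  by rewrite ler_pdivrMr// ?(lt_trans _ d1)// ler_peMr// ltW.
rewrite (le_trans _ (_ : S <= _))//; last by rewrite lerDl exprn_ge0// ltW.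
have ex : exists k, d <= 2 ^+ k * dyad R j.
  by exists j; rewrite /dyad -exprMn divff// expr1n.
case: (ex_minnP ex) => -[|k] dk kmin.
  rewrite (le_trans (riesz_le1 _ _ dy0))//.
  apply: le_trans (Sk ord0 dk); rewrite expr0 expr1n divr1.
  by rewrite exprn_ege1// ler1n.
have kj : (k.+1 < j.+1)%N.
  by rewrite ltnS; apply: kmin; rewrite /dyad -exprMn divff// expr1n.
apply: le_trans (Sk (Ordinal kj) dk) => /=.
have kd : 2 ^+ k * dyad R j < d.
  by rewrite ltNge; apply/negP => /kmin; rewrite ltnn.
have dd : dyad R j <= d.
  by apply: le_trans (ltW kd); rewrite ler_peMl ?(ltW dy0)// exprn_ege1// ler1n.
rewrite /riesz max_r// -expr_div_n lerXn2r ?nnegrE ?divr_ge0// ?(ltW dy0)//.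
rewrite ler_pdivrMr; last by rewrite (lt_le_trans dy0).
by rewrite exprS invfM mulrA divff// mul1r mulrC ler_pdivlMr ?exprn_gt0//
  mulrC ltW.
Qed.

(** Null sets are carried from [mu] to its image through preimages of measurable sets. Restricting e
    to the values 1 / (k + 1) keeps the intersections countable. *)
Lemma measurable_thin (R : realType) n (nu : probability (borel 'rV[R]_n) R) (t
  : R) :
  measurable [set z : borel 'rV[R]_n | thin nu t z].
Proof.
rewrite (_ : [set z | _] = \bigcap_k \bigcap_J \bigcup_(j in [set j | (J <=
  j)%N])
  [set z : borel 'rV[R]_n | (nu (eball z (dyad R j)) < (k.+1%:R^-1 * dyad R j
    `^ t)%:E)%E]).
  apply: bigcapT_measurable => k; apply: bigcapT_measurable => J.
  apply: bigcup_measurable => j _; rewrite -[X in measurable X]setTI.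
  by apply: emeasurable_fun_infty_o => //; exact: measurable_fun_measure_eball.
apply/seteqP; split => z /=.
  move=> tz k _ J _; have [j Jj jz] := tz k.+1%:R^-1 J ltac:(by rewrite
    invr_gt0).
  by exists j.
move=> tz e J e0.
have [k ke] : exists k, e^-1 <= k.+1%:R.
  exists (Num.truncn e^-1); have := truncnS_gt e^-1; rewrite ?num_real//.
  exact: ltW.
have [j Jj jz] := tz k I J I; exists j => //.
apply: (lt_le_trans jz); rewrite lee_fin ler_wpM2r ?powR_ge0//.
by rewrite invf_ple// posrE.
Qed.

Section Projection.
Variables (R : realType) (n : nat) (mu : probability (borel 'rV[R]_n) R).
Variable V : {vspace 'rV[R]_n}.
Let m := \dim V.
Variable B : 'M[R]_(m, n).
Hypothesis BV : orthonormal_in V B.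

Lemma measurable_orthproj (W : {vspace 'rV[R]_n}) :
  measurable_fun setT (orthproj W : borel 'rV[R]_n -> borel 'rV[R]_n).
Proof.
rewrite (_ : orthproj W = fun x => x *m lin1_mx (orthproj W)).
  exact: measurable_mulmxr.
by apply/funext => x; rewrite /orthproj mul_rV_lin1.
Qed.

Variables (P : probability (borel 'rV[R]_n) R) (N : probability (borel
  'rV[R]_m) R).
Hypothesis PE : (P : set (borel 'rV[R]_n) -> \bar R) =
  pushforward mu (orthproj V : borel 'rV[R]_n -> borel 'rV[R]_n).
Hypothesis NE : (N : set (borel 'rV[R]_m) -> \bar R) =
  pushforward mu ((fun x => x *m B^T) : borel 'rV[R]_n -> borel 'rV[R]_m).

Lemma proj_eball x (r : R) : P (eball (orthproj V x) r) =
  mu [set y | enorm (orthproj V (y - x)) <= r].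
Proof using PE.
by rewrite PE /pushforward; congr (mu _); apply/seteqP; split => y;
  rewrite /eball /= orthprojB.
Qed.

(** Together with [proj_eball]: corresponding balls have the same mass under [P] and [N], so all
    local estimates may be made in R^m. *)
Lemma coord_eball x (r : R) : N (eball (x *m B^T) r) =
  mu [set y | enorm (orthproj V (y - x)) <= r].
Proof using NE BV.
rewrite NE /pushforward; congr (mu _).
by apply/seteqP; split => y; rewrite /eball /= -mulmxBl -enorm_orthproj_basis.
Qed.

Lemma thin_proj_coord t x : thin P t (orthproj V x) <-> thin N t (x *m B^T).
Proof using PE NE BV.
by split=> H e J e0; have [j Jj je] := H e J e0; exists j => //; move: je;
  rewrite proj_eball coord_eball.
Qed.

(** The null cells of side 1 / (m + 1) are countably many, and the cell of z lies in the unit ball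
    about z. *)
Lemma ae_eball1_gt0 : {ae N, forall z : 'rV[R]_m,
  (0 < N (eball z (dyad R 0)))%E}.
Proof.
pose h : R := m.+1%:R^-1.
have h0 : 0 < h by rewrite invr_gt0.
pose D : set 'rV[int]_m := [set a | N (cell h a) = 0%E].
have mcell a : measurable (cell h a : set (borel 'rV[R]_m)) by exact:
  measurable_cell.
have N0 : N (\bigcup_(a in D) cell h a) = 0%E.
  apply/eqP; rewrite eq_le measure_ge0 andbT.
  apply: (le_trans (measure_countable_bigcup_le N D mcell)).
  by rewrite esum1.
have : N.-negligible (\bigcup_(a in D) cell h a).
  by apply/negligibleP => //; exact: measurable_countable_bigcup.
apply: negligibleS => z /= nz; exists (grid_index h z) => //.
apply/eqP; rewrite eq_le measure_ge0 andbT.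
have : (N (eball z (dyad R 0)) <= 0)%E by rewrite leNgt; apply/negP.
apply: le_trans; apply: le_measure; rewrite ?inE//;
  first exact: measurable_eball.
move=> y yz; have := cell_diam h0 yz (erefl : cell h (grid_index h z) z).
by rewrite /eball /= /h divff.
Qed.

(* Doubling between the scales 1 and 2^-j bounds nu(B(z, 2^-j)) from below by
   nu(B(z, 1)) 2^(-jt). *)
Lemma not_ae_thin t : m%:R < t -> ~ {ae P, forall z : 'rV[R]_n, thin P t z}.
Proof using PE NE BV.
move=> mt Pt.
have Ft : {ae mu, forall x : 'rV[R]_n, thin N t (x *m B^T)}.
  have := ae_pushforward (measurable_orthproj V) PE Pt.
  by apply: (@filterS _ _ (ae_filter_ringOfSetsType mu)) => x /thin_proj_coord.
(* Chosen so that 2^m g^2 2^-t = 1, balancing the doubling loss against thinness. *)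
pose g : R := 2 `^ ((t - m%:R) / 2).
have g1 : 1 < g.
  have u0 : 0 < (t - m%:R) / 2 by rewrite divr_gt0// subr_gt0.
  have := @gt0_ltr_powR R _ u0 1 2; rewrite powR1; apply; rewrite ?nnegrE//.
  by rewrite ltr1n.
have mB := @measurable_mulmxr R n m B^T.
have F1 := ae_pushforward mB NE (ae_doubling N g1).
have F2 := ae_pushforward mB NE ae_eball1_gt0.
have FP : ProperFilter (almost_everywhere mu).
  have mu0 : (0 < mu setT)%E by rewrite probability_setT.
  exact: ae_properfilter_algebraOfSetsType mu0.
have [x [tx [[J HJ] px]]] : exists x : 'rV[R]_n, thin N t (x *m B^T) /\
  ((exists J, forall j k, (J <= j)%N -> (k <= j)%N ->
    (N (eball (x *m B^T) (2 ^+ k * dyad R j)) <=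
     ((2 ^+ k) ^+ m * g ^+ (2 * j))%:E * N (eball (x *m B^T) (dyad R j)))%E) /\
   (0 < N (eball (x *m B^T) (dyad R 0)))%E).
  exact: filter_ex (filterI Ft (filterI F1 F2)).
have Nfin : N (eball (x *m B^T) (dyad R 0)) \is a fin_num.
  by rewrite fin_num_measure//; exact: measurable_eball.
(* Thinness is tested with the mass of the unit ball as tolerance; doubling with k = j then makes
   that mass smaller than itself. *)
pose e := fine (N (eball (x *m B^T) (dyad R 0))).
have eE : N (eball (x *m B^T) (dyad R 0)) = e%:E by rewrite fineK.
have e0 : 0 < e by rewrite -lte_fin -eE.
have [j Jj je] := tx e J e0.
have := HJ j j Jj (leqnn j).
have -> : 2 ^+ j * dyad R j = dyad R 0 by rewrite /dyad -exprMn divff//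
  expr1n expr0.
rewrite eE leNgt => /negP; apply.
have a0 : 0 < (2 ^+ j) ^+ m * g ^+ (2 * j) by rewrite mulr_gt0 ?exprn_gt0//
  (lt_trans _ g1).
apply: (@lt_le_trans _ _ (((2 ^+ j) ^+ m * g ^+ (2 * j))%:E * (e * dyad R j `^
  t)%:E)%E).
  by rewrite lte_pmul2l.
rewrite -EFinM lee_fin mulrCA -[leRHS]mulr1 ler_pM2l// -/(g ^+ (2 * j)).
have -> : (2 ^+ j) ^+ m = (2 ^+ m) ^+ j :> R by rewrite -!exprM mulnC.
rewrite /dyad powR_exprn ?invr_ge0// exprM -!exprMn.
have -> : 2 ^+ m * g ^+ 2 * 2^-1 `^ t = 1 :> R; last by rewrite expr1n.
rewrite -powR_inv1// -!powRrM -!powR_mulrn ?powR_ge0// /g -powRrM divfK//.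
have two0 : (2 : R) != 0 by [].
rewrite -!powRD ?two0 ?implybT//.
by rewrite (_ : m%:R + (t - m%:R) + -1 * t = 0) ?powRr0//; ring.
Qed.

Lemma packing_dim_proj_le : (packing_dim_measure P <= m%:R%:E)%E.
Proof using PE NE BV.
apply/lee_addgt0Pr => e e0; rewrite -EFinD.
apply: packing_dim_measure_le; first by rewrite addr_ge0// ltW.
by apply: not_ae_thin; rewrite ltrDl.
Qed.

Lemma packing_dim_proj_ge :
  (forall t, t < m%:R -> {ae mu, forall x : 'rV[R]_n, thin N t (x *m B^T)}) ->
  (m%:R%:E <= packing_dim_measure P)%E.
Proof using PE NE BV.
move=> H; apply: packing_dim_measure_ge => t tm.
have mT := measurable_thin P t.
have mp := measurable_orthproj V.
have mpT : measurable ((orthproj V : borel 'rV[R]_n -> borel 'rV[R]_n) @^-1`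
    (~` [set z : borel 'rV[R]_n | thin P t z])).
  by rewrite -[X in measurable X]setTI; apply: mp => //; exact: measurableC.
have neg : mu.-negligible ((orthproj V : borel 'rV[R]_n -> borel 'rV[R]_n) @^-1`
    (~` [set z : borel 'rV[R]_n | thin P t z])).
  have := H t tm; apply: negligibleS => x /= nt tx.
  by apply: nt; apply/thin_proj_coord.
have P0 : P (~` [set z : borel 'rV[R]_n | thin P t z]) = 0%E.
  by rewrite PE; exact: (measure_negligible mpT neg).
by apply/negligibleP => //; exact: measurableC.
Qed.

Lemma packing_dim_proj_ge_thin t : (0 < m)%N ->
  (m%:R%:E <= packing_dim_measure P)%E ->
  t < m%:R -> {ae mu, forall x : 'rV[R]_n, thin N t (x *m B^T)}.
Proof using PE NE BV.
(* The bound on the packing dimension from above requires a nonnegative exponent; m > 0 keeps it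
   below m. *)
move=> m0 mP tm; pose t1 := Num.max t 0.
have t1m : t1 < m%:R by rewrite gt_max tm ltr0n.
have t10 : 0 <= t1 by rewrite le_max lexx orbT.
have Pt1 : {ae P, forall z : 'rV[R]_n, thin P t1 z}.
  apply: contrapT => /(packing_dim_measure_le t10)/(le_trans mP).
  by rewrite lee_fin leNgt t1m.
have := ae_pushforward (measurable_orthproj V) PE Pt1.
apply: (@filterS _ _ (ae_filter_ringOfSetsType mu)) =>
  x /thin_proj_coord H e J e0.
have [j Jj je] := H e J e0; exists j => //; apply: (lt_le_trans je).
rewrite lee_fin ler_pM2l//; apply: ger_powR; first by rewrite dyad_gt0 dyad_le1.
by rewrite le_max lexx.
Qed.

(** Integrates [riesz_le_dyadic_sum]; a ball about x lies in the preimage of the projected ball of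
    the same radius, because projections do not increase length. *)
Lemma profile_le_coord x j :
  (profile mu m x (dyad R j) <=
   \sum_(k < j.+1) (2 ^+ m / (2 ^+ k) ^+ m)%:E * N (eball (x *m B^T) (2 ^+ k *
     dyad R j))
   + (dyad R j ^+ m)%:E)%E.
Proof using NE BV.
pose A k : set (borel 'rV[R]_n) := [set y | enorm (x - (y : 'rV[R]_n)) <= 2 ^+
  k * dyad R j].
have mA k : measurable (A k) by apply: measurable_le_cst;
  exact: measurable_enorm_sub.
have c0 k : (0 <= (2 ^+ m / (2 ^+ k) ^+ m : R)%:E)%E.
  by rewrite lee_fin divr_ge0 ?exprn_ge0.
have mI k : measurable_fun setT (fun y : borel 'rV[R]_n =>
    (2 ^+ m / (2 ^+ k) ^+ m)%:E * (\1_(A k) y)%:E)%E.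
  by apply: measurable_funeM; apply/measurable_EFinP; exact: measurable_indic.
have I0 k (y : borel 'rV[R]_n) : (0 <= (2 ^+ m / (2 ^+ k) ^+ m)%:E * (\1_(A k)
  y)%:E)%E.
  by rewrite mule_ge0// lee_fin.
apply: (@le_trans _ _ (\int[mu]_y (\sum_(k < j.+1)
    (2 ^+ m / (2 ^+ k) ^+ m)%:E * (\1_(A k) y)%:E + cst (dyad R j ^+ m)%:E
      y))%E).
  apply: ge0_le_integral => //.
  - by move=> y _; rewrite lee_fin riesz_ge0// ltW// dyad_gt0.
  - apply/measurable_EFinP; apply: (measurableT_comp _ (measurable_enorm_sub
    x)).
    by apply: measurable_riesz; exact: dyad_gt0.
  - by apply: emeasurable_funD => //; apply: emeasurable_sum => k; exact: mI.
  - move=> y _; under eq_bigr do rewrite -EFinM;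
    rewrite /= sumEFin -EFinD lee_fin.
    apply: (le_trans (riesz_le_dyadic_sum _ _ (enorm_ge0 _))); rewrite lerD2r.
    apply: ler_sum => k _; rewrite ler_wpM2l ?divr_ge0 ?exprn_ge0// indicE.
    case: (boolP (enorm (x - y) <= _)) => [xy|_]; last exact: ler0n.
    by rewrite mem_set.
rewrite ge0_integralD//; last 3 first.
- by move=> y _; apply: sume_ge0 => k _; exact: I0.
- by apply: emeasurable_sum => k; exact: mI.
- by move=> y _; rewrite lee_fin exprn_ge0// ltW// dyad_gt0.
apply: leeD; last first.
  rewrite integral_cst// -[leRHS]mule1; apply: lee_wpmul2l.
    by rewrite lee_fin exprn_ge0// ltW// dyad_gt0.
  exact: probability_le1.
rewrite ge0_integral_sum//.
apply: lee_sum => k _; rewrite ge0_integralZl//; last first.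
  by apply/measurable_EFinP; exact: measurable_indic.
apply: lee_wpmul2l => //; rewrite integral_indic// setIT coord_eball.
apply: le_measure; rewrite ?inE//.
  apply: measurable_le_cst.
  apply: (@measurable_enorm _ _ _ (borel 'rV[R]_n) (fun y =>
    orthproj V (y - x))) => i.
  rewrite (_ : (fun _ => _) = (fun y : borel 'rV[R]_n =>
    (orthproj V y : 'rV[R]_n) ord0 i - (orthproj V x) ord0 i)); last first.
    by apply/funext => y; rewrite orthprojB !mxE.
  apply: measurable_funB => //.
  exact: (measurableT_comp (measurable_coord i) (measurable_orthproj V)).
move=> y; rewrite /A /= enorm_distC; apply: le_trans.
exact: enorm_orthproj_le.
Qed.

Lemma packing_dim_proj_thin_profile t : (0 < m)%N ->
  (m%:R%:E <= packing_dim_measure P)%E ->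
  t < m%:R -> {ae mu, forall x : 'rV[R]_n, thin_profile mu m t x}.
Proof using PE NE BV.
move=> m0 mP tm; pose t1 := (t + m%:R) / 2.
have t1m : t1 < m%:R by rewrite /t1; lra.
have tt1 : t < t1 by rewrite /t1; lra.
(* Doubling costs g^(2j) and the number j + 1 of terms costs g^j; the third makes the total g^(3j) =
   2^(j (t1 - t)), exactly the gap between thinness at t1 and at t. *)
pose g : R := 2 `^ ((t1 - t) / 3).
have g1 : 1 < g.
  have u0 : 0 < (t1 - t) / 3 by rewrite divr_gt0// subr_gt0.
  have := @gt0_ltr_powR R _ u0 1 2; rewrite powR1; apply; rewrite ?nnegrE//.
  by rewrite ltr1n.
have g0 : 0 < g by exact: lt_trans g1.
have mB := @measurable_mulmxr R n m B^T.
have F1 := ae_pushforward mB NE (ae_doubling N g1).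
have F2 := packing_dim_proj_ge_thin m0 mP t1m.
move: F1 F2.
apply: (@filterS2 _ _ (ae_filter_ringOfSetsType mu)) => x [J HJ] tx e J' e0.
pose C : R := 2 ^+ m * (1 + (g - 1)^-1).
have C0 : 0 < C.
  by rewrite mulr_gt0 ?exprn_gt0// addr_gt0// invr_gt0 subr_gt0.
have [J2 HJ2] : exists J2, forall j, (J2 <= j)%N ->
  dyad R j ^+ m <= e / 2 * dyad R j `^ t.
  have u0 : 0 < m%:R - t by rewrite subr_gt0.
  have e20 : 0 < e / 2 by rewrite divr_gt0.
  have := @dyad_small R ((e / 2) `^ (m%:R - t)^-1) (powR_gt0 _ e20).
  move=> [J2 HJ2]; exists J2 => j jJ2.
  rewrite -powR_mulrn ?(ltW (dyad_gt0 _ _))// -{1}(subrK t m%:R) powRD;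
    last first.
    by apply/implyP => _; rewrite gt_eqF// dyad_gt0.
  rewrite ler_pM2r ?powR_gt0 ?dyad_gt0//.
  have eE : e / 2 = ((e / 2) `^ (m%:R - t)^-1) `^ (m%:R - t).
    by rewrite -powRrM mulVf ?powRr1 ?(ltW e20)// gt_eqF.
  rewrite [leRHS]eE.
  by apply: ge0_ler_powR; rewrite ?nnegrE ?(ltW u0) ?powR_ge0 ?(ltW (dyad_gt0 _
    _))// HJ2.
have eC0 : 0 < e / 2 / C by rewrite !divr_gt0.
have [j] := tx (e / 2 / C) (maxn J (maxn J' J2)) eC0.
rewrite !geq_max => /and3P[jJ jJ' jJ2] je; exists j => //.
apply: (le_lt_trans (profile_le_coord x j)).
set b := N _ in je.
apply: (@lt_le_trans _ _ ((e / 2 * dyad R j `^ t)%:E + (e / 2 * dyad R j `^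
  t)%:E)%E); last first.
  by rewrite -EFinD lee_fin -mulrDl -splitr.
apply: lte_leD => //; last by rewrite lee_fin HJ2.
apply: (@le_lt_trans _ _ (\sum_(k < j.+1) (2 ^+ m * g ^+ (2 * j))%:E * b)%E).
  apply: lee_sum => k _.
  apply: (@le_trans _ _ ((2 ^+ m / (2 ^+ k) ^+ m)%:E * (((2 ^+ k) ^+ m * g ^+
    (2 * j))%:E * b))%E).
    apply: lee_wpmul2l; first by rewrite lee_fin divr_ge0 ?exprn_ge0.
    by apply: HJ => //; rewrite -ltnS.
  by rewrite muleA -EFinM mulrA divfK ?expf_neq0// lexx.
have bfin : b \is a fin_num by rewrite fin_num_measure//;
  exact: measurable_eball.
rewrite -(fineK bfin) in je *.
under eq_bigr do rewrite -EFinM.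
rewrite sumEFin lte_fin sumr_const card_ord -[ltLHS]mulr_natl.
move: je; rewrite lte_fin; set b' := fine b => je.
have b0 : 0 <= b' by apply: fine_ge0; exact: measure_ge0.
apply: (@le_lt_trans _ _ (C * g ^+ (3 * j) * b')).
  rewrite [leLHS]mulrA ler_wpM2r//.
  have -> : C * g ^+ (3 * j) = (1 + (g - 1)^-1) * g ^+ j * (2 ^+ m * g ^+ (2 *
    j)).
    by rewrite (_ : 3 * j = j + 2 * j)%N ?exprD /C; [ring|lia].
  by rewrite ler_pM2r ?natS_le_expr// mulr_gt0 ?exprn_gt0.
apply: (@lt_le_trans _ _ (C * g ^+ (3 * j) * (e / 2 / C * dyad R j `^ t1))).
  by rewrite ltr_pM2l// mulr_gt0// exprn_gt0.
rewrite [leLHS](_ : _ = e / 2 * (g ^+ (3 * j) * dyad R j `^ t1)); last first.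
  by field; rewrite gt_eqF.
rewrite ler_pM2l ?divr_gt0// /dyad !powR_exprn ?invr_ge0// exprM -exprMn.
have -> : g ^+ 3 * 2^-1 `^ t1 = 2^-1 `^ t; last exact: lexx.
rewrite -powR_inv1// -!powRrM -powR_mulrn ?powR_ge0// /g -powRrM divfK//.
rewrite -powRD; last by apply/implyP.
by congr (_ `^ _); ring.
Qed.

End Projection.

(** * Exchanging almost-everywhere quantifiers for lower limits *)

Section LiminfZero.
Variable R : realType.
Local Open Scope ereal_scope.

Definition liminf_zero (u : nat -> \bar R) : Prop :=
  forall (e : R) J, (0 < e)%R -> exists2 j, (J <= j)%N & u j < e%:E.

Lemma liminf_zeroP (u : nat -> \bar R) : (forall j, 0 <= u j) ->
  liminf_zero u <-> limn_einf u = 0.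
Proof.
move=> u0; rewrite limn_einf_lim; split => [H|H e J e0].
  apply/eqP; rewrite eq_le; apply/andP; split.
    apply: lime_le; first exact: is_cvg_einfs.
    apply: nearW => k; apply/lee_addgt0Pr => e e0; rewrite add0e.
    have [j kj ue] := H e k e0; apply: le_trans (ltW ue).
    by apply: ereal_inf_lbound; exists j.
  apply: lime_ge; first exact: is_cvg_einfs.
  by apply: nearW => k; apply: le_ereal_inf_tmp => _ [j _ <-].
have : einfs u J < e%:E.
  apply: (@le_lt_trans _ _ 0); last by rewrite lte_fin.
  rewrite -H (cvg_lim _ (@cvg_einfs_sup _ u))//.
  by apply: ereal_sup_ubound; exists J.
by move=> /ereal_inf_lt[_ [j /= Jj <-] ue]; exists j.
Qed.

End LiminfZero.

Section FubiniFatou.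
Context d1 d2 (T1 : measurableType d1) (T2 : measurableType d2) (R : realType).
Variables (m1 : probability T1 R) (m2 : probability T2 R).
Variable w : nat -> T1 * T2 -> \bar R.
Hypothesis mw : forall j, measurable_fun setT (w j).
Hypothesis w0 : forall j p, (0 <= w j p)%E.

(** For almost every x, Fatou's lemma in V makes the integral of the lower limit h over V vanish.
    Tonelli's theorem exchanges the integrals, and a nonnegative function with zero double integral
    vanishes for a.e. x, for a.e. V. *)
Lemma ae_ae_liminf_zero :
  {ae m2, forall x, liminf_zero (fun j => \int[m1]_V w j (V, x))%E} ->
  {ae m1, forall V, {ae m2, forall x, liminf_zero (fun j => w j (V, x))}}.
Proof using mw w0.
move=> H; pose h p := limn_einf (w^~ p).
have h0 p : (0 <= h p)%E.
  rewrite /h limn_einf_lim; apply: lime_ge; first exact: is_cvg_einfs.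
  by apply: nearW => k; apply: le_ereal_inf_tmp => _ [j _ <-].
have mh : measurable_fun setT h.
  apply: (@emeasurable_fun_cvg _ _ _ _ (fun k p => einfs (w^~ p) k)).
    by move=> k; apply: measurable_fun_einfs.
  by move=> p _; rewrite /h limn_einf_lim; exact: is_cvg_einfs.
have m2h : measurable_fun setT (fun x => \int[m1]_V h (V, x))%E.
  exact: (measurable_fun_fubini_tonelli_G (m1 := m1) h mh h0).
have m1h : measurable_fun setT (fun V => \int[m2]_x h (V, x))%E.
  exact: (measurable_fun_fubini_tonelli_F (m2 := m2) h mh h0).
have swap := fubini_tonelli (m1 := m1) (m2 := m2) h mh h0.
have int0 : (\int[m2]_x \int[m1]_V h (V, x) = 0)%E.
  rewrite (@ae_eq_integral _ _ _ m2 setT (cst 0%E))//;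
    first by rewrite integral0.
  move: H; apply: (@filterS _ _ (ae_filter_ringOfSetsType m2)) => x Hx _ /=.
  have F := @fatou _ _ _ m1 setT measurableT (fun j V => w j (V, x))
    (fun j => measurableT_comp (mw j) (pair2_measurable x)) (fun j V _ =>
      w0 j (V, x)).
  apply/eqP; rewrite eq_le; apply/andP; split; last exact: integral_ge0.
  apply: (le_trans F).
  by rewrite ((liminf_zeroP _).1 Hx)// => j; apply: integral_ge0.
have : (\int[m1]_V `|\int[m2]_x h (V, x)| = 0)%E.
  rewrite -[RHS]int0 -swap; apply: eq_integral => V _; rewrite gee0_abs//.
  exact: integral_ge0.
move=> /(ae_eq_integral_abs m1 measurableT m1h).
apply: (@filterS _ _ (ae_filter_ringOfSetsType m1)) => V /(_ I) hV.
have mhV : measurable_fun setT (fun x => h (V, x)).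
  exact: (measurableT_comp mh (pair1_measurable V)).
have : (\int[m2]_x `|h (V, x)| = 0)%E.
  by rewrite -[RHS]hV; apply: eq_integral => x _; rewrite gee0_abs.
move=> /(ae_eq_integral_abs m2 measurableT mhV).
apply: (@filterS _ _ (ae_filter_ringOfSetsType m2)) => x /(_ I) hx.
by apply/liminf_zeroP.
Qed.

End FubiniFatou.

(** * Averages over the Grassmannian *)

Section RandomProjections.
Variables (R : realType) (n m : nat) (le_mn : (m <= n)%N).
Variable mu : probability (borel 'rV[R]_n) R.
Variable gamma : probability (borel (grassmann R le_mn)) R.
Hypothesis gamma_rot : rotation_invariant gamma.

(** The preimage of the ball of radius r about the projection of x. Keeping [mu] fixed and letting
    the set vary with V makes its mass measurable jointly in (V, x), as the measure of a section. *)
Definition tube (V : grassmann R le_mn) (x : 'rV[R]_n) (r : R) : set (borel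
  'rV[R]_n) :=
  [set y | enorm (orthproj (sval V) ((y : 'rV[R]_n) - x)) <= r].

Lemma orthproj_sub_coordE (V : grassmann R le_mn) (x y : 'rV[R]_n) j :
  orthproj (sval V) (y - x) ord0 j =
  \sum_i (y ord0 i - x ord0 i) * grassmann_mx V i j.
Proof. by rewrite orthproj_grassmann_mx mxE; apply: eq_bigr => i _;
  rewrite !mxE. Qed.

Lemma measurable_tube_measure (r : R) :
  measurable_fun setT (fun p : borel (grassmann R le_mn) * borel 'rV[R]_n =>
    mu (tube p.1 p.2 r)).
Proof.
pose A : set ((borel (grassmann R le_mn) * borel 'rV[R]_n) * borel 'rV[R]_n) :=
  [set q | enorm (orthproj (sval (q.1.1 : grassmann R le_mn))
    ((q.2 : 'rV[R]_n) - q.1.2)) <= r].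
have mA : measurable A.
  apply: measurable_le_cst; apply: measurable_enorm => j.
  under eq_fun do rewrite orthproj_sub_coordE.
  apply: measurable_sum => i; apply: measurable_funM.
    apply: measurable_funB.
      exact: (measurableT_comp (measurable_coord i) measurable_snd).
    exact: (measurableT_comp (measurableT_comp (measurable_coord i)
      measurable_snd) measurable_fst).
  exact: (measurableT_comp (measurableT_comp (@measurable_grassmann_mx R n m
    le_mn i j) measurable_fst) measurable_fst).
rewrite (_ : (fun p => _) = mu \o xsection A);
  first exact: measurable_fun_xsection.
apply/funext => p /=; congr (mu _).
by apply/seteqP; split => y; rewrite /xsection /= inE.
Qed.

Lemma integral_tube_le : exists C : R, 0 <= C /\ forall x r, 0 < r ->
  (\int[gamma]_V mu (tube V x r) <= C%:E * profile mu m x r)%E.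
Proof using gamma_rot.
have [C [C0 HC]] := small_proj_le gamma_rot.
exists C; split => // x r r0.
pose A : set (borel (grassmann R le_mn) * borel 'rV[R]_n) :=
  [set q | enorm (orthproj (sval (q.1 : grassmann R le_mn)) ((q.2 : 'rV[R]_n) -
    x)) <= r].
have mA : measurable A.
  apply: measurable_le_cst; apply: measurable_enorm => j.
  under eq_fun do rewrite orthproj_sub_coordE.
  apply: measurable_sum => i; apply: measurable_funM.
    apply: measurable_funB => //.
    exact: (measurableT_comp (measurable_coord i) measurable_snd).
  exact: (measurableT_comp (@measurable_grassmann_mx R n m le_mn i j)
    measurable_fst).
have swap := @indic_fubini_tonelli _ _ _ _ _ gamma mu A mA.
rewrite indic_fubini_tonelli_FE// indic_fubini_tonelli_GE// in swap.
have -> : (\int[gamma]_V mu (tube V x r) = \int[mu]_y gamma (ysection A y))%E.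
  transitivity (\int[gamma]_V (mu \o xsection A) V)%E; last exact: swap.
  apply: eq_integral => V _ /=; congr (mu _).
  by apply/seteqP; split => y; rewrite /xsection /= inE.
rewrite -ge0_integralZl//; last 2 first.
- apply/measurable_EFinP; apply: (measurableT_comp _ (measurable_enorm_sub x)).
  exact: measurable_riesz.
- by move=> y _; rewrite lee_fin riesz_ge0// ltW.
apply: ge0_le_integral => //.
- exact: measurable_fun_ysection.
- apply: measurable_funeM; apply/measurable_EFinP.
  apply: (measurableT_comp _ (measurable_enorm_sub x)); exact: measurable_riesz.
- move=> y _; rewrite -EFinM (_ : ysection A y = small_proj (y - x) r).
    by rewrite enorm_distC; exact: HC.
  by apply/seteqP; split => V; rewrite /ysection /= inE.
Qed.

Lemma ae_ae_tube t : {ae mu, forall x : 'rV[R]_n, thin_profile mu m t x} ->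
  {ae gamma, forall V : grassmann R le_mn, {ae mu, forall x : 'rV[R]_n,
    liminf_zero (fun j => (dyad R j `^ (- t))%:E * mu (tube V x (dyad R
      j)))%E}}.
Proof using gamma_rot.
move=> H; have [C [C0 HC]] := integral_tube_le.
apply: (@ae_ae_liminf_zero _ _ _ _ _ gamma mu
  (fun j p => (dyad R j `^ (- t))%:E * mu (tube p.1 p.2 (dyad R j)))%E).
- by move=> j; apply: measurable_funeM; exact: measurable_tube_measure.
- by move=> j p; rewrite mule_ge0// lee_fin powR_ge0.
move: H; apply: (@filterS _ _ (ae_filter_ringOfSetsType mu)) => x Hx e J e0.
(* C may be 0, and a positive constant is needed to divide e. *)
have C10 : 0 < C + 1 by rewrite ltr_pwDr.
have eC0 : 0 < e / (C + 1) by rewrite divr_gt0.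
have [j Jj je] := Hx _ J eC0; exists j => //=.
have mt : measurable_fun setT (fun V : borel (grassmann R le_mn) =>
  mu (tube V x (dyad R j))).
  exact: (measurableT_comp (measurable_tube_measure (dyad R j))
    (pair2_measurable (x : borel 'rV[R]_n))).
rewrite ge0_integralZl//; last by rewrite lee_fin powR_ge0.
rewrite powRN -lte_pdivlMl ?invr_gt0 ?powR_gt0 ?dyad_gt0// invrK -EFinM.
apply: (le_lt_trans (HC x _ (dyad_gt0 R j))).
apply: (@le_lt_trans _ _ ((C + 1)%:E * profile mu m x (dyad R j))%E).
  apply: lee_wpmul2r; last by rewrite lee_fin lerDl.
  by apply: integral_ge0 => y _; rewrite lee_fin riesz_ge0// ltW// dyad_gt0.
rewrite -lte_pdivlMl//; apply: (lt_le_trans je).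
rewrite -EFinM lee_fin le_eqVlt; apply/orP; left; apply/eqP.
by field; rewrite gt_eqF.
Qed.

End RandomProjections.

Unset Implicit Arguments.
Set Strict Implicit.
Set Printing Implicit Defensive.

Theorem theorem5p1 (R : realType) (n m : nat)
    (m_ge1 : (1 <= m)%N) (le_mn : (m <= n)%N)
    (mu : probability (borel 'rV[R]_n) R)
    (gamma : probability (borel (grassmann R le_mn)) R) :
  compact (msupport mu) ->
  rotation_invariant gamma ->
  ({ae gamma, forall V,
      packing_dim_measure (measure_proj mu V) = m%:R%:E} <->
   m%:R <= threshold mu).
Proof.
move=> _ rot.
have laws (V : grassmann R le_mn) : exists (B : 'M[R]_(\dim (sval V),
  n)) (P : probability (borel 'rV[R]_n) R)
    (N : probability (borel 'rV[R]_(\dim (sval V))) R),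
  [/\ orthonormal_in (sval V) B,
     (P : set (borel 'rV[R]_n) -> \bar R) = measure_proj mu V &
     (N : set (borel 'rV[R]_(\dim (sval V))) -> \bar R) =
       pushforward mu ((fun x => x *m B^T) : borel 'rV[R]_n ->
         borel 'rV[R]_(\dim (sval V)))].
  have [B BV] := orthonormal_inP (leqnn (\dim (sval V))).
  have [P PE] := pushforward_probability mu (measurable_orthproj (sval V)).
  have [N NE] := pushforward_probability mu (measurable_mulmxr B^T).
  by exists B, P, N.
have dimV (V : grassmann R le_mn) : \dim (sval V) = m by apply/eqP;
  exact: (svalP V).
split=> [dimE|/(threshold_geP _ m_ge1 le_mn).1 H].
  apply/threshold_geP => // t tm.
  (* Positive total mass makes the almost-everywhere filter proper, so that one subspace V can be
     extracted. *)
  have gamma0 : (0 < gamma setT)%E by rewrite probability_setT.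
  have FP := ae_properfilter_algebraOfSetsType gamma0.
  have [V VE] := @filter_ex _ _ FP _ dimE.
  have [B [P [N [BV PE NE]]]] := laws V.
  rewrite -(dimV V); apply: (packing_dim_proj_thin_profile BV PE NE);
    rewrite dimV//.
  by rewrite PE VE.
(* Countably many exponents increasing to m, so that a single null set of subspaces serves for all
   of them. *)
have tk k : m%:R - k.+1%:R^-1 < m%:R :> R by rewrite gtrBl invr_gt0.
have {}H k := ae_ae_tube rot (H _ (tk k)).
have : {ae gamma, forall V : grassmann R le_mn, forall k, {ae mu,
  forall x : 'rV[R]_n,
    liminf_zero (fun j => (dyad R j `^ (- (m%:R - k.+1%:R^-1)))%:E * mu (tube V
      x (dyad R j)))%E}}.
  exact: ae_foralln.
apply: (@filterS _ _ (ae_filter_ringOfSetsType gamma)) => V HV.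
have [B [P [N [BV PE NE]]]] := laws V.
apply/eqP; rewrite eq_le -PE -(dimV V) (packing_dim_proj_le BV PE NE)/=.
apply: (packing_dim_proj_ge BV PE NE) => t tm.
have {}tm : t < m%:R by rewrite -(dimV V).
(* Dyadic radii are at most 1, so thinness at the larger exponent implies thinness at t. *)
have [k tk'] : exists k, t <= m%:R - k.+1%:R^-1.
  exists (Num.truncn (m%:R - t)^-1); rewrite lerBrDr -lerBrDl.
  rewrite invf_ple ?posrE ?subr_gt0//; apply: ltW.
  by have := truncnS_gt (m%:R - t)^-1; rewrite ?num_real.
have := HV k; apply: (@filterS _ _ (ae_filter_ringOfSetsType mu)) =>
  x Hx e J e0.
have [j Jj je] := Hx e J e0; exists j => //.
rewrite (coord_eball BV NE); apply: (@lt_le_trans _ _ (e * dyad R j `^ (m%:R -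
  k.+1%:R^-1))%:E).
  move: je; rewrite powRN -lte_pdivlMl ?invr_gt0 ?powR_gt0 ?dyad_gt0//
    invrK -EFinM.
  by rewrite mulrC.
rewrite lee_fin ler_pM2l//; apply: ger_powR => //.
by rewrite dyad_gt0 dyad_le1.
Qed.
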